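(* Let $n\ge 2$, $m\ge 1$, and let $u=(u_i)_{i=1}^m:\mathbb{R}^n\to\mathbb{R}^m$ be a classical solution of $$-\operatorname{div}\big(\Phi'(|\nabla u_i|^2)\nabla u_i\big)=H_i(u)\quad\text{in }\mathbb{R}^n,\qquad i=1,\dots,m.$$ Write $x=(x',x_n)\in\mathbb{R}^{n-1}\times\mathbb{R}$. Assume that the integral $$\int_{\mathbb{R}^{n-1}}\left(\sum_{i=1}^m\left[\tfrac12\Phi(|\nabla u_i|^2)-\Phi'(|\nabla u_i|^2)|\partial_{x_n}u_i|^2\right]-\tilde H(u)\right)dx'$$ is finite for at least one value of $x_n$, and that $$\sum_{i=1}^m\int_0^{x_n}\int_{\partial B_R(0)}\Phi'(|\nabla u_i|^2)\,\partial_{\nu_{x'}}u_i\,\partial_{x_n}u_i$$ tends to zero as $R\to\infty$ along a sequence, where $B_R(0)$ is the ball of radius $R$ in $\mathbb{R}^{n-1}$. Then there exists a constant $C$ such that for every $x_n\in\mathbb{R}$ $$\int_{\mathbb{R}^{n-1}}\left(\sum_{i=1}^m\left[\tfrac12\Phi(|\nabla u_i|^2)-\Phi'(|\nabla u_i|^2)|\partial_{x_n}u_i|^2\right]-\tilde H(u)\right)dx'= C.$$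
   Context: Standing assumptions: $\Phi\in C^2(\mathbb{R}^+)$, $\Phi(0)=0$, and $\Phi(s)$, $\Phi'(s)$ and $\Phi'(s)+2s\Phi''(s)$ are positive for $s>0$. Each $H_i\in C^1(\mathbb{R}^m)$ is real valued; with $\partial_jH_i(u)=\partial H_i(u)/\partial u_j$ one assumes $\partial_iH_j(u)\,\partial_jH_i(u)>0$ for $1\le i\le j\le m$. $\tilde H:\mathbb{R}^m\to\mathbb{R}$ is a function (assumed to exist) with $\partial_i\tilde H=H_i$ for all $i$. $\partial_{\nu_{x'}}$ denotes the derivative in the direction of the outward unit normal to $\partial B_R(0)\subset\mathbb{R}^{n-1}$ (acting in the $x'$ variables).
   Formalization: The integral over R^{n-1} is the limit of integrals over the balls B_R along the given sequence of radii (one for all x_n); the Lebesgue integral is shown to equal C at each x_n where it exists, since its existence at every x_n can fail. *)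

(* Defs.v *)
From HB Require Import structures.
From mathcomp Require Import all_boot all_order all_algebra.
From mathcomp Require Import all_classical all_reals all_analysis.

Set Implicit Arguments.
Unset Strict Implicit.
Unset Printing Implicit Defensive.
Import Order.TTheory GRing.Theory Num.Theory.
Import numFieldNormedType.Exports.

Local Open Scope classical_set_scope.
Local Open Scope ring_scope.

Section Calculus.
Context {R : realType} {d : nat}.
Implicit Types (f : 'rV[R]_d -> R) (x : 'rV[R]_d).

Definition partial (j : 'I_d) f x : R := 'D_(delta_mx 0 j) f x.

Definition C1 f : Prop :=
  (forall x, differentiable f x) /\ (forall j, continuous (partial j f)).

Definition C2 f : Prop := C1 f /\ (forall j, C1 (partial j f)).

(* |grad f|^2 for the Euclidean norm; the library norm on 'rV is the sup norm *)
Definition grad_sq f x : R := \sum_(j < d) partial j f x ^+ 2.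

Definition divergence (F : 'I_d -> 'rV[R]_d -> R) x : R :=
  \sum_(j < d) partial j (F j) x.

(* Phi'(|grad f|^2) grad f.  Where grad f = 0 this vector is 0, whatever
   (possibly meaningless) value the expression derive1 Phi takes at 0. *)
Definition flux (Phi : R -> R) f (j : 'I_d) x : R :=
  derive1 Phi (grad_sq f x) * partial j f x.

End Calculus.

(* Only the values of Phi on [0, +oo[ matter.  Phi is C^2 on ]0, +oo[ and
   continuous up to 0; this covers both Phi in C^2([0, +oo[) and the
   p-Laplacian Phi(s) = (2/p) s^(p/2), p > 1. *)
Definition admissible_Phi {R : realType} (Phi : R -> R) : Prop :=
  [/\ {within `[0, +oo[, continuous Phi},
      forall s, 0 < s ->
        [/\ derivable Phi s 1, derivable (derive1 Phi) s 1 &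
            {for s, continuous (derive1n 2 Phi)}],
      Phi 0 = 0 &
      forall s, 0 < s ->
        [/\ 0 < Phi s, 0 < derive1 Phi s &
            0 < derive1 Phi s + 2 * s * derive1n 2 Phi s]].

Section System.
Context {R : realType} {d m : nat}.

Definition values (u : 'I_m -> 'rV[R]_d -> R) (x : 'rV[R]_d) : 'rV[R]_m :=
  \row_i u i x.

(* The second condition says that the field under the divergence is C^1, so
   that the equation makes sense pointwise; it follows from the first one when
   Phi is C^2 up to 0. *)
Definition classical_solution (Phi : R -> R) (H : 'I_m -> 'rV[R]_m -> R)
    (u : 'I_m -> 'rV[R]_d -> R) : Prop :=
  [/\ forall i, C2 (u i),
      forall i j, C1 (flux Phi (u i) j) &
      forall i x, - divergence (flux Phi (u i)) x = H i (values u x)].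

End System.

Section LebesgueMeasure.
Context {R : realType}.

Definition tuple_cons N (p : N.-tuple R * measurableTypeR R) : N.+1.-tuple R :=
  [the N.+1.-tuple R of p.2 :: p.1].

Lemma measurable_tuple_cons N :
  measurable_fun [set: N.-tuple R * measurableTypeR R] (@tuple_cons N).
Proof. by apply: measurable_cons. Qed.

Definition image_measure d1 d2 (T1 : measurableType d1)
    (T2 : measurableType d2) (mu : {measure set T1 -> \bar R}) (f : T1 -> T2)
    (mf : measurable_fun [set: T1] f) : {measure set T2 -> \bar R}.
Proof. exact: (pushforward mu f). Defined.

Fixpoint lebesgueN (N : nat) : {measure set (N.-tuple R) -> \bar R} :=
  match N with
  | 0 => \d_([tuple] : 0.-tuple R)
  | N'.+1 => image_measure
      (product_measure1 (lebesgueN N') (@lebesgue_measure R))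
      (@measurable_tuple_cons N')
  end.

Lemma lebesgueNS N (A : set (N.+1.-tuple R)) :
  lebesgueN N.+1 A =
  ((lebesgueN N \x @lebesgue_measure R) (@tuple_cons N @^-1` A))%E.
Proof. by []. Qed.

End LebesgueMeasure.

Section Slices.
Context {R : realType} {N : nat}.
Implicit Types (y : N.-tuple R) (g : N.-tuple R -> R) (r t : R).

Definition enorm y : R := Num.sqrt (\sum_(j < N) tnth y j ^+ 2).

Definition scale r y : N.-tuple R := [tuple r * tnth y j | j < N].

Definition eball r : set (N.-tuple R) := [set y | enorm y < r].

(* The point (y, t) of R^N x R, with t as last coordinate *)
Definition join y t : 'rV[R]_N.+1 :=
  \row_j (if unlift ord_max j is Some k then tnth y k else t).

Definition ball_integral r g : R := \int[lebesgueN N]_(y in eball r) g y.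

(* Integral over the sphere of radius r for its surface measure
   r^(N-1) sigma, where sigma is the surface measure of the unit sphere,
     sigma(A) = N * Leb {y | 0 < |y| < 1 and y/|y| in A},
   i.e. N times the image of Leb restricted to the unit ball by y |-> y/|y|.
   For N = 1 it is g(r) + g(-r). *)
Definition sphere_integral r g : R :=
  N%:R * r ^+ N.-1 *
  \int[lebesgueN N]_(y in eball 1) g (scale (r / enorm y) y).

(* l is the integral of g over R^N, understood as the limit of the integrals
   over the balls of radii r_k *)
Definition is_integral_along (r : nat -> R) g (l : R) : Prop :=
  (fun k => ball_integral (r k) g) @ \oo --> l.

(* The Lebesgue integral of g makes sense, possibly with an infinite value *)
Definition has_lebesgue_integral g : Prop :=
  measurable_fun [set: N.-tuple R] g /\
  ((\int[lebesgueN N]_y (EFin \o g)^\+ y < +oo)%E \/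
   (\int[lebesgueN N]_y (EFin \o g)^\- y < +oo)%E).

(* Derivative of f at (y, t) in the direction y / |y|, the outward unit normal
   at y to the sphere through y in R^N *)
Definition normal_derivative (f : 'rV[R]_N.+1 -> R) y t : R :=
  \sum_(j < N) tnth y j / enorm y * partial (lift ord_max j) f (join y t).

End Slices.

(* int_0^t f, with the usual sign convention when t < 0 *)
Definition oriented_integral {R : realType} (f : R -> R) (t : R) : R :=
  if 0 <= t then \int[@lebesgue_measure R]_(s in `[0, t]) f s
  else - \int[@lebesgue_measure R]_(s in `[t, 0]) f s.

Section Hamiltonian.
Context {R : realType} {N m : nat}.
Variables (Phi : R -> R) (Ht : 'rV[R]_m -> R) (u : 'I_m -> 'rV[R]_N.+1 -> R).

Definition hamiltonian_density (t : R) (y : N.-tuple R) : R :=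
  let x := join y t in
  (\sum_(i < m) (2^-1 * Phi (grad_sq (u i) x)
     - derive1 Phi (grad_sq (u i) x) * `|partial ord_max (u i) x| ^+ 2))
  - Ht (values u x).

Definition lateral_flux (r t : R) : R :=
  \sum_(i < m) oriented_integral (fun s => sphere_integral r (fun y =>
    derive1 Phi (grad_sq (u i) (join y s)) * normal_derivative (u i) y s
    * partial ord_max (u i) (join y s))) t.

End Hamiltonian.

(* Main.v *)
Require Import Defs.
From HB Require Import structures.
From mathcomp Require Import all_boot all_order all_algebra.
From mathcomp Require Import all_classical all_reals all_analysis.
From mathcomp Require Import measurable_realfun ring lra.
Import Order.TTheory GRing.Theory Num.Theory.
Import numFieldNormedType.Exports.
Set Implicit Arguments.
Unset Strict Implicit.
Unset Printing Implicit Defensive.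
Local Open Scope classical_set_scope.
Local Open Scope ring_scope.

(** The density
      e = sum_i [Phi(|grad u_i|^2) / 2 - F_{i,n} d_n u_i] - Ht(u),
    where F_i = Phi'(|grad u_i|^2) grad u_i, obeys a conservation law:
      d_n e = sum_{j < n} d_j P_j   with   P_j = sum_i F_{i,j} d_n u_i.
    Indeed d_n (Phi(|grad u|^2) / 2) = sum_j F_j d_n d_j u, second derivatives
    commute, and the equation turns - d_n (Ht(u)) = - sum_i H_i(u) d_n u_i into
    sum_i (div F_i) d_n u_i; what remains is the divergence of P in the
    variables x' (is_derive_energy).  Only the points where grad u = 0 are
    delicate, since Phi need not be differentiable at 0.  There the ellipticity
    condition Phi' + 2 s Phi'' > 0 helps: it makes 2 s Phi'(s) - Phi(s)
    increasing, whence 0 <= Phi(s) <= 2 s Phi'(s), so Phi(|grad u|^2) lies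
    between 0 and 2 grad u . F, a C1 function which vanishes there together
    with its derivatives (is_derive_Phi_grad_sq).

    Integrate over the ball B_r of R^(n-1), apply the divergence theorem, then
    integrate in x_n: the integral of e(., t) over B_r minus that of e(., 0) is
    the flux through the lateral boundary of the cylinder (lateral_fluxE).
    This flux tends to 0 along the radii r_k.  Hence if the integrals over the
    balls converge at one height, they converge to the same limit at every
    height; when e(., t) has a Lebesgue integral, that limit is the integral,
    by monotone convergence for the positive and the negative parts
    (lebesgue_integral_of_balls).

    Since the surface measure is defined by projecting the Lebesgue measure of
    the unit ball onto the sphere, the divergence theorem (divergence_ball) is
    an identity between integrals over solid balls, and no parametrization of
    the sphere is needed.  By dilation the radius may be taken to be 1.
    - The integral of d_j phi vanishes when phi is C1 with support in the ball
      (integral_partial0): Fubini, and the fundamental theorem of calculus on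
      the lines parallel to the j-th axis.
    - Hence a C1 field Z tangent to the sphere has a divergence of integral 0
      over the ball (integral_div_tangential): for a cutoff chi, the extra term
      grad chi . Z stays bounded because x . Z vanishes on the sphere, and it
      tends to 0 pointwise.
    - Put K(x) = x . G(x).  The field G(x) - x K(x / |x|) is tangent to the
      sphere, and x K(x / |x|) has divergence N K(x / |x|), its last factor
      being homogeneous of degree 0.  The singularity at 0 is removed by
      replacing x / |x| with x / sqrt((1 - d) |x|^2 + d), which still is x
      itself on the sphere, and d then tends to 0 (divergence_unit_ball). *)

(** * Directional derivatives *)

Section DirectionalDerivatives.
Context {R : realType}.

Lemma coord_norm_le d (v : 'rV[R]_d) i : `|v 0 i| <= `|v|.
Proof.
rewrite [leRHS]/Num.Def.normr/= mx_normrE.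
exact: (@le_bigmax _ R _ 0 (fun j => `|v j.1 j.2|) (0, i)).
Qed.

Lemma row_norm_le d (v : 'rV[R]_d) c :
  0 <= c -> (forall i, `|v 0 i| <= c) -> `|v| <= c.
Proof.
move=> c0 vc; rewrite [leLHS]/Num.Def.normr/= mx_normrE bigmax_le// => -[i j] _.
by rewrite /= (ord1 i).
Qed.

Lemma derive_partial d (f : 'rV[R]_d -> R) x v : differentiable f x ->
  'D_v f x = \sum_(j < d) v 0 j * partial j f x.
Proof.
move=> df; rewrite deriveE// {1}(row_sum_delta v) linear_sum.
by apply: eq_bigr => j _; rewrite linearZ /partial deriveE.
Qed.

Lemma differentiable_row (V : normedModType R) m (g : 'I_m -> V -> R) x :
  (forall i, differentiable (g i) x) ->
  differentiable (fun y => \row_i g i y) x.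
Proof.
move=> dg; rewrite (_ : (fun _ => _) =
    \sum_(i < m) (fun y => g i y *: (delta_mx 0 i : 'rV[R]_m))).
  by apply: differentiable_sum => i; exact: differentiableZl.
apply/funext => y; rewrite fct_sumE [LHS]row_sum_delta.
by apply: eq_bigr => i _; rewrite mxE.
Qed.

Lemma derive_comp_row (V : normedModType R) m (f : 'rV[R]_m -> R)
    (g : 'I_m -> V -> R) x v :
  (forall i, differentiable (g i) x) -> differentiable f (\row_i g i x) ->
  'D_v (fun y => f (\row_i g i y)) x =
  \sum_(i < m) 'D_v (g i) x * partial i f (\row_i g i x).
Proof.
move=> dg df; have dG := differentiable_row dg.
rewrite deriveE; last exact: differentiable_comp.
rewrite (@diff_comp _ _ _ _ _ f)//= -[LHS]deriveE// derive_partial//.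
apply: eq_bigr => i _; congr (_ * _).
rewrite -deriveE// derive_mx ?mxE.
  by congr ('D_v _ x); apply/funext => y; rewrite mxE.
exact: diff_derivable.
Qed.

Lemma continuous_row (T : topologicalType) m (g : 'I_m -> T -> R) x :
  (forall i, {for x, continuous (g i)}) ->
  {for x, continuous (fun y => \row_i g i y)}.
Proof.
move=> cg; apply/cvgrPdist_le => e e0.
have : \forall y \near x, forall i, `|g i x - g i y| <= e.
  by apply: filter_forall => i; have /cvgrPdist_le/(_ _ e0) := cg i.
apply: filterS => y H.
apply: row_norm_le (ltW e0) _ => i.
by rewrite !mxE; exact: H.
Qed.

(** Both difference quotients are the same function of h. *)
Lemma is_derive_lineP (V : normedModType R) (f : V -> R) x v s l :
  is_derive (x + s *: v) v f l <-> is_derive s 1 (fun t => f (x + t *: v)) l.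
Proof.
have E : (fun h => h^-1 *: (((fun t => f (x + t *: v)) \o shift s) (h *: 1)
           - f (x + s *: v))) =
         (fun h => h^-1 *: ((f \o shift (x + s *: v)) (h *: v)
           - f (x + s *: v))).
  apply/funext => h /=; congr (_ *: (f _ - _)).
  by rewrite -[h *: 1]/(h * 1) mulr1 scalerDl addrCA.
split=> -[df Df]; (split; first by move: df; rewrite /derivable E).
- by rewrite -Df /derive E.
- by rewrite -Df /derive E.
Qed.

Lemma is_derive_scale (V : normedModType R) (f : V -> R) x v c l :
  is_derive x v f l -> is_derive x (c *: v) f (c * l).
Proof.
rewrite -{1 2}[x]addr0 -{1}(scale0r v) -(scale0r (c *: v)).
move=> /(is_derive_lineP f x v 0 l).1 fl.
apply: (is_derive_lineP f x (c *: v) 0 _).2.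
rewrite (_ : (fun t => _) = (fun t => f (x + t *: v)) \o (fun t => t * c));
    last first.
  by apply/funext => t /=; rewrite scalerA.
rewrite mulrC; apply: is_derive1_comp; first by rewrite mul0r.
rewrite -[X in is_derive _ _ _ X]mul1r mulrC.
rewrite (_ : (fun t => t * c) = c *: id); last by apply/funext => t;
    rewrite mulrC.
exact: is_deriveZ.
Qed.

Lemma MVT_line (V : normedModType R) (f : V -> R) (df : R -> R) x v :
  (forall s : R, 0 <= s <= 1 ->
    is_derive (x + s *: v) v f (df s)) ->
  exists2 s : R, 0 <= s <= 1 & f (x + v) - f x = df s.
Proof.
move=> Hf.
have Hl (s : R) : s \in `[0, 1] ->
    is_derive s 1 (fun t => f (x + t *: v)) (df s).
  by rewrite in_itv/= => s01; exact: (is_derive_lineP f x v s _).1 (Hf _ s01).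
have Ho (s : R) : s \in `]0, 1[ ->
    is_derive s 1 (fun t => f (x + t *: v)) (df s).
  by move=> s01; apply: Hl; apply: subset_itv_oo_cc.
have Hc : {within `[0, 1], continuous (fun t : R => f (x + t *: v))}.
  by apply: derivable_within_continuous => s /Hl [].
have [c c01] := MVT_segment ler01 Ho Hc.
rewrite scale1r scale0r addr0 subr0 mulr1 => ->; exists c => //.
Qed.

(** Continuous partial derivatives give differentiability: go from x to x + v
    by moving one coordinate at a time, and apply the mean value theorem to each
    of the moves. *)
Lemma differentiable_partials d (f : 'rV[R]_d -> R)
    (h : 'I_d -> 'rV[R]_d -> R) x :
  (forall i y, is_derive y (delta_mx 0 i) f (h i y)) ->
  (forall i, {for x, continuous (h i)}) -> differentiable f x.
Proof.
move=> fh ch.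
(* After subtracting the candidate differential L, the differential to find
   is 0. *)
pose L (y : 'rV[R]_d) := \sum_(i < d) h i x *: y 0 i.
have dL y : differentiable L y.
  rewrite (_ : L = \sum_(i < d) (fun y : 'rV[R]_d => h i x *: (y 0 i : R))).
    by apply: differentiable_sum => i; apply: differentiableZ;
       exact: differentiable_coord.
  by apply/funext => z; rewrite fct_sumE.
have -> : f = (f - L) + L by rewrite subrK.
apply: differentiableD; last exact: dL.
set g := f - L.
suff Hg : g \o shift x = cst (g x) + (\0 : 'rV[R]_d -> R) +o_ (0 : 'rV[R]_d) id.
  apply/diff_locallyP; rewrite (@diff_unique _ _ _ g \0 x) //.
  - by split => // y; exact: cst_continuous.
  - by move=> y; exact: cst_continuous.
apply/eqaddoP => e e0.
have e'0 : 0 < e / d.+1%:R by rewrite divr_gt0.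
have HD : \forall y \near x, forall i, `|h i x - h i y| <= e / d.+1%:R.
  apply: (@filter_forall _ _ (fun i y =>
      `|h i x - h i y| <= e / d.+1%:R) (nbhs x)) => i.
  by have /cvgrPdist_le/(_ _ e'0) := ch i.
have /nbhs_ballP[D /= D0 {}HD] := HD.
have HD0 := @nbhs0_lt _ 'rV[R]_d _ D0.
apply: (@filterS _ (nbhs (0 : 'rV[R]_d)) _ [set v | `|v| < D] _ _ HD0) =>
    v /= vD.
rewrite /g /= !fctE addr0.
(* w k keeps the first k coordinates of v: from w 0 = 0 to w d = v. *)
pose w k : 'rV[R]_d := \row_i (if (i < k)%N then v 0 i else 0).
have w0 : w 0%N = 0 by apply/rowP => i; rewrite !mxE.
have wd : w d = v by apply/rowP => i; rewrite !mxE ltn_ord.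
have wv k (y : 'rV[R]_d) : (forall i, `|y 0 i| <= `|w k.+1 0 i|) ->
    `|y| <= `|v|.
  move=> Hy; apply: row_norm_le => // i; rewrite (le_trans (Hy i))// mxE.
  by case: ifP => _; rewrite ?normr0//; exact: coord_norm_le.
have wS k (kd : (k < d)%N) : w k.+1 = w k + v 0 (Ordinal kd) *:
    delta_mx 0 (Ordinal kd).
  apply/rowP => i; rewrite !mxE eqxx/= ltnS leq_eqVlt -val_eqE/=.
  case: ltngtP => //= ik; rewrite ?mulr0 ?addr0//.
  by rewrite mulr1 add0r; congr (v 0 _); exact/val_inj.
have step (k : 'I_d) : `|f (x + w k.+1) - f (x + w k) - h k x * v 0 k|
    <= e / d.+1%:R * `|v|.
  case: k => k' kd; rewrite /= (wS k' kd) addrA; set kk := Ordinal kd.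
  have Hd (s : R) : 0 <= s <= 1 -> is_derive
      (x + w k' + s *: (v 0 kk *: delta_mx 0 kk)) (v 0 kk *: delta_mx 0 kk) f
      (v 0 kk * h kk (x + w k' + s *: (v 0 kk *: delta_mx 0 kk))).
    by move=> _; exact: is_derive_scale.
  have [s /andP[s0 s1] ->] :=
    @MVT_line _ f (fun s =>
        v 0 kk * h kk (x + w k' + s *: (v 0 kk *: delta_mx 0 kk)))
      _ _ Hd.
    set z := w k' + s *: (v 0 kk *: delta_mx 0 kk).
    have zv : `|z| <= `|v|.
      apply: (wv k') => i; rewrite /z wS !mxE eqxx /= -val_eqE /=.
      case: ltngtP => //= ik;
          rewrite ?mulr0 ?addr0// !mulr1 !add0r normrM ger0_norm//.
      by rewrite ler_piMl.
    rewrite mulrC -mulrBl normrM -distrC ler_pM//.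
      rewrite -addrA; apply: HD;
          rewrite -ball_normE /ball_/= opprD addrA subrr sub0r normrN.
      exact: le_lt_trans vD.
    exact: coord_norm_le.
have -> : f (v + x) - L (v + x) - (f x - L x) =
    \sum_(k < d) (f (x + w k.+1) - f (x + w k) - h k x * v 0 k).
  rewrite sumrB -(big_mkord xpredT (fun k => f (x + w k.+1) - f (x + w k))).
  rewrite telescope_sumr// wd w0 addr0 (addrC v).
  suff <- : L (x + v) - L x = \sum_(k < d) h k x * v 0 k by ring.
  rewrite /L -sumrB; apply: eq_bigr => i _.
  by rewrite -scalerBr mxE [x 0 i + _]addrC addrK.
apply: le_trans (ler_norm_sum _ _ _) _.
apply: le_trans (ler_sum _ (fun i _ => step i)) _.
rewrite sumr_const card_ord -mulrnAl ler_wpM2r// -mulrnAr ger_pMr//.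
by rewrite -[_ *+ d]mulr_natl mulrC ler_pdivrMl// mulr1 ler_nat.
Qed.
End DirectionalDerivatives.

(** * Second derivatives and functions of class C1 *)

Section C1Functions.
Context {R : realType}.

Lemma derive_comp1 (V : normedModType R) (phi : R -> R) (g : V -> R) x v l :
  is_derive (g x) 1 phi l -> differentiable g x ->
  'D_v (fun y => phi (g y)) x = l * 'D_v g x.
Proof.
move=> [dphi <-] dg; have /derivable1_diffP dphi' := dphi.
rewrite deriveE; last exact: differentiable_comp.
rewrite (@diff_comp _ _ _ _ _ phi)//= deriv1E// -deriveE//= derive1E.
by rewrite -[LHS]/('D_v g x * 'D_1 phi (g x)) mulrC.
Qed.

Lemma is_derive_translate (V : normedModType R) (f : V -> R) x c v l :
  is_derive (x + c) v f l -> is_derive x v (fun y => f (y + c)) l.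
Proof.
have E : (fun h => h^-1 *: (((fun y => f (y + c)) \o shift x) (h *: v)
           - f (x + c))) =
         (fun h => h^-1 *: ((f \o shift (x + c)) (h *: v) - f (x + c))).
  by apply/funext => h /=; rewrite addrA.
move=> -[df Df]; split; first by move: df; rewrite /derivable E.
by rewrite -Df /derive E.
Qed.

(** The second difference of f over a parallelogram of sides h e_i and h e_j is
    h^2 times the value of either mixed derivative at some nearby point, by two
    applications of the mean value theorem; then h tends to 0. *)
Lemma schwarz d (f : 'rV[R]_d -> R) i j x : C2 f ->
  partial i (partial j f) x = partial j (partial i f) x.
Proof.
move=> [[df _] C1f].
pose S (h : R) := f (x + h *: delta_mx 0 i + h *: delta_mx 0 j)
  - f (x + h *: delta_mx 0 i) - f (x + h *: delta_mx 0 j) + f x.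
have key a b (h : R) : exists s t : R, [/\ 0 <= s <= 1, 0 <= t <= 1 &
   f (x + h *: delta_mx 0 a + h *: delta_mx 0 b)
  - f (x + h *: delta_mx 0 a) - f (x + h *: delta_mx 0 b) + f x
  = h * (h * partial b (partial a f)
      (x + s *: (h *: delta_mx 0 a) + t *: (h *: delta_mx 0 b)))].
  set ea := h *: delta_mx 0 a; set eb := h *: delta_mx 0 b.
  pose g y := f (y + eb) - f y.
  have Hd (s : R) : 0 <= s <= 1 -> is_derive (x + s *: ea) ea g
      (h * (partial a f (x + s *: ea + eb) - partial a f (x + s *: ea))).
    move=> _; apply: is_derive_scale; apply: is_deriveB; last first.
      by apply/derivableP/diff_derivable.
    by apply: is_derive_translate; exact/derivableP/diff_derivable.
  have [s s01 gs] := MVT_line Hd.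
  have He (t : R) : 0 <= t <= 1 ->
      is_derive (x + s *: ea + t *: eb) eb (partial a f)
        (h * partial b (partial a f) (x + s *: ea + t *: eb)).
    move=> _; apply: is_derive_scale; apply/derivableP/diff_derivable.
    by have [] := C1f a.
  have [t t01 gt] := MVT_line He.
  exists s, t; split => //.
  by rewrite -gt -gs /g; ring.
apply/eqP; rewrite -subr_eq0 -normr_le0; apply/ler_addgt0Pl => e e0.
rewrite addr0.
have e20 : 0 < e / 2 by rewrite divr_gt0.
have Cont a b : exists2 r : R, 0 < r & forall y : 'rV[R]_d, `|y| < r ->
   `|partial a (partial b f) x - partial a (partial b f) (x + y)| < e / 2.
  have [_ /(_ a x)/cvgrPdist_lt/(_ _ e20)/nbhs_ballP[r /= r0 Hr]] := C1f b.
  exists r => // y yr; apply: Hr.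
  by rewrite -ball_normE /ball_/= opprD addrA subrr sub0r normrN.
have [r1 r10 H1] := Cont i j; have [r2 r20 H2] := Cont j i.
set M := `|delta_mx 0 i : 'rV[R]_d| + `|delta_mx 0 j : 'rV[R]_d|.
have M0 : 0 < M + 1 by rewrite ltr_wpDl// addr_ge0.
have rm : 0 < Num.min r1 r2 by rewrite lt_min r10.
have [h h0 hM] : exists2 h : R, 0 < h & h * M < Num.min r1 r2.
  exists (Num.min r1 r2 / 2 / (M + 1)); first by rewrite !divr_gt0.
  have M1 : 0 <= M by rewrite addr_ge0.
  by rewrite mulrAC ltr_pdivrMr//; nra.
have small (s t : R) a b : `|delta_mx 0 a : 'rV[R]_d| + `|delta_mx 0 b :
    'rV[R]_d| = M ->
   0 <= s <= 1 -> 0 <= t <= 1 ->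
   `|s *: (h *: delta_mx 0 a) + t *: (h *: delta_mx 0 b) : 'rV[R]_d| < Num.min
       r1 r2.
  move=> Mab /andP[s0 s1] /andP[t0 t1]; apply: le_lt_trans hM.
  rewrite (le_trans (ler_normD _ _))// -Mab mulrDr !normrZ.
  by rewrite !ger0_norm ?(ltW h0)// lerD// ler_piMl// mulr_ge0// ltW.
have mr1 : Num.min r1 r2 <= r1 by rewrite ge_min lexx.
have mr2 : Num.min r1 r2 <= r2 by rewrite ge_min lexx orbT.
have [s [t [s01 t01 E1]]] := key i j h.
have [s' [t' [s01' t01' E2]]] := key j i h.
have := H2 _ (lt_le_trans (small s t i j erefl s01 t01) mr2).
have := H1 _ (lt_le_trans (small s' t' j i (addrC _ _) s01' t01') mr1).
rewrite !addrA.
have E3 : partial j (partial i f)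
    (x + s *: (h *: delta_mx 0 i) + t *: (h *: delta_mx 0 j)) =
  partial i (partial j f)
      (x + s' *: (h *: delta_mx 0 j) + t' *: (h *: delta_mx 0 i)).
  have hN : h != 0 by rewrite gt_eqF.
  move: E2; rewrite (addrAC x) -[X in X + f x]addrAC E1.
  by move=> /(mulfI hN)/(mulfI hN).
rewrite E3; set P := partial i (partial j f) (_ + _) => A1 A2.
rewrite (splitr e) -[X in `|X|](subrKA P).
apply: le_trans (ler_normD _ _) _; apply: lerD (ltW A1) _.
by rewrite distrC; exact: ltW.
Qed.

Lemma continuous_sum (T : topologicalType) m (f : 'I_m -> T -> R) x :
  (forall i, {for x, continuous (f i)}) ->
  {for x, continuous (fun y => \sum_(i < m) f i y)}.
Proof.
elim: m f => [|m IH] f cf.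
  rewrite (_ : (fun y => _) = (fun=> 0)); first exact: cst_continuous.
  by apply/funext => y; rewrite big_ord0.
rewrite (_ : (fun y => _) =
  f ord0 \+ (fun y => \sum_(i < m) f (lift ord0 i) y)).
  apply: continuousD; first exact: cf.
  by apply: IH => i; exact: cf.
by apply/funext => y; rewrite big_ord_recl.
Qed.

Lemma C1_continuous d (f : 'rV[R]_d -> R) : C1 f -> continuous f.
Proof. by move=> [df _] x; apply: differentiable_continuous. Qed.

Lemma C1_cst d (c : R) : C1 (fun _ : 'rV[R]_d => c).
Proof.
split=> [x|j]; first exact: differentiable_cst.
rewrite (_ : partial j _ = cst 0); first exact: cst_continuous.
by apply/funext => x; rewrite /partial derive_cst.
Qed.

Lemma derive_coord d (i : 'I_d) (x v : 'rV[R]_d) :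
  'D_v (fun y : 'rV[R]_d => y 0 i) x = v 0 i.
Proof.
have := @derive_mx R _ 1 d id x v (@derivable_id _ _ x v).
by rewrite derive_id => /rowP/(_ i); rewrite mxE.
Qed.

Lemma C1_coord d (i : 'I_d) : C1 (fun y : 'rV[R]_d => y 0 i).
Proof.
split=> [x|j]; first exact: differentiable_coord.
rewrite (_ : partial j _ = cst ((delta_mx 0 j : 'rV[R]_d) 0 i)).
  exact: cst_continuous.
by apply/funext => x; rewrite /partial derive_coord.
Qed.

Lemma C1D d (f g : 'rV[R]_d -> R) : C1 f -> C1 g -> C1 (fun x => f x + g x).
Proof.
move=> [df cf] [dg cg]; split=> [x|j]; first exact: differentiableD.
rewrite (_ : partial j _ = partial j f \+ partial j g).
  by move=> x; apply: continuousD; [exact: cf|exact: cg].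
by apply/funext => x; apply: deriveD; exact: diff_derivable.
Qed.

Lemma partialM d (f g : 'rV[R]_d -> R) j x :
  differentiable f x -> differentiable g x ->
  partial j (fun y => f y * g y) x = f x * partial j g x + g x * partial j f x.
Proof. by move=> df dg; apply: deriveM; exact: diff_derivable. Qed.

Lemma C1M d (f g : 'rV[R]_d -> R) : C1 f -> C1 g -> C1 (fun x => f x * g x).
Proof.
move=> Cf Cg; have := C1_continuous Cf; have := C1_continuous Cg.
move: Cf Cg => [df cf] [dg cg] Cg Cf; split=> [x|j];
    first exact: differentiableM.
rewrite (_ : partial j _ = (f \* partial j g) \+ (g \* partial j f)).
  move=> x; apply: continuousD; apply: continuousM.
  - exact: Cf.
  - exact: cg.
  - exact: Cg.
  - exact: cf.
by apply/funext => x; apply: partialM.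
Qed.

Lemma C1B d (f g : 'rV[R]_d -> R) : C1 f -> C1 g -> C1 (fun x => f x - g x).
Proof.
move=> Cf Cg; rewrite (_ : (fun x => _) = (fun x => f x + (-1) * g x)).
  by apply: C1D => //; apply: C1M => //; exact: C1_cst.
by apply/funext => x; rewrite mulN1r.
Qed.

Lemma C1_sum d m (f : 'I_m -> 'rV[R]_d -> R) : (forall i, C1 (f i)) ->
  C1 (fun x => \sum_(i < m) f i x).
Proof.
move=> Cf; elim: m f Cf => [|m IH] f Cf.
  rewrite (_ : (fun x => _) = (fun=> 0)); first exact: C1_cst.
  by apply/funext => x; rewrite big_ord0.
rewrite (_ : (fun x => _) = (fun x =>
    f ord0 x + \sum_(i < m) f (lift ord0 i) x)).
  by apply: C1D => //; exact: IH.
by apply/funext => x; rewrite big_ord_recl.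
Qed.

Lemma C1_comp_row d m (f : 'rV[R]_m -> R) (g : 'I_m -> 'rV[R]_d -> R) :
  C1 f -> (forall i, C1 (g i)) -> C1 (fun x => f (\row_i g i x)).
Proof.
move=> [df cf] Cg; have dg i x : differentiable (g i) x by have [] := Cg i.
have cg i : continuous (g i) := C1_continuous (Cg i).
split=> [x|j].
  by apply: (@differentiable_comp _ _ _ _ _ f) => //; apply: differentiable_row.
rewrite (_ : partial j _ = fun x =>
    \sum_(i < m) partial j (g i) x * partial i f (\row_i g i x)).
  move=> x; apply: continuous_sum => i; apply: continuousM;
      first by have [_ /(_ j x)] := Cg i.
  apply: (@continuous_comp _ _ _ (fun x => \row_i g i x) (partial i f)).
    by apply: continuous_row => k; exact: cg.
  exact: cf.
by apply/funext => x; exact: derive_comp_row.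
Qed.

Lemma C1_comp1 d (phi dphi : R -> R) (a : 'rV[R]_d -> R) : C1 a ->
  (forall x, is_derive (a x) 1 phi (dphi (a x))) ->
  (forall x, {for a x, continuous dphi}) -> C1 (fun x => phi (a x)).
Proof.
move=> Ca phid cphi; have ca := C1_continuous Ca; move: Ca => [da pa].
split=> [x|j].
  apply: (@differentiable_comp _ _ _ _ _ phi) => //.
  by apply/derivable1_diffP; have [] := phid x.
rewrite (_ : partial j _ = fun x => dphi (a x) * partial j a x).
  move=> x; apply: (@continuousM _ _ (fun x => dphi (a x)) (partial j a) x);
      last exact: pa.
  by apply: (@continuous_comp _ _ _ a dphi); [exact: ca|exact: cphi].
by apply/funext => x; apply: derive_comp1.
Qed.
End C1Functions.

(** * Lebesgue measure on tuples: measurability, Fubini, dilations, balls *)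

Section Measurability.
Context {R : realType}.

Definition row_of N (y : N.-tuple R) : 'rV[R]_N := \row_j tnth y j.

(** Rounding every coordinate down to a multiple of 1 / (k + 1) gives a
    measurable map with countably many values, and f is the pointwise limit of
    its composites with these maps. *)
Lemma measurable_continuous_row N (f : 'rV[R]_N -> R) : continuous f ->
  measurable_fun [set: N.-tuple R] (fun y => f (row_of y)).
Proof.
move=> cf.
pose z (k : nat) (y : N.-tuple R) : {ffun 'I_N -> int} :=
  [ffun j => Num.floor (k.+1%:R * tnth y j)].
pose c (k : nat) (p : {ffun 'I_N -> int}) : 'rV[R]_N :=
  \row_j ((p j)%:~R / k.+1%:R).
have zc k y : `|row_of y - c k (z k y)| <= k.+1%:R^-1.
  apply: row_norm_le => [|j]; first by rewrite invr_ge0.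
  rewrite !mxE ffunE; have := floor_itv (k.+1%:R * tnth y j) => /andP[h1 h2].
  have k0 : 0 < k.+1%:R :> R by [].
  rewrite ler_norml; apply/andP; split.
    rewrite (@le_trans _ _ 0)// ?oppr_le0 ?invr_ge0//.
    by rewrite subr_ge0 ler_pdivrMr// [tnth y j * _]mulrC.
  rewrite -(ler_pM2l k0) mulrBr mulrCA divff ?mulr1 ?gt_eqF//.
  by move: h2; rewrite intrD => h2; rewrite lerBlDl ltW.
apply: (@measurable_realfun.measurable_fun_cvg _ _ _ _
  (fun k y => f (c k (z k y)))) => [k|y _]; last first.
  apply/cvgrPdist_lt => e e0.
  have /cvgrPdist_lt/(_ _ e0)/nbhs_ballP[r /= r0 Hr] := cf (row_of y).
  near=> k; apply: Hr; rewrite -ball_normE /ball_/=.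
  apply: le_lt_trans (zc k y) _.
  by near: k; exact: (near_infty_natSinv_lt (PosNum r0)).
move=> _ B mB; rewrite setTI.
rewrite (_ : _ @^-1` B = \bigcup_(p in [set p | B (f (c k p))]) [set y | z k y
    = p]); last first.
  apply/seteqP; split => y /=; first by move=> By; exists (z k y).
  by move=> [p /= Bp zp]; rewrite zp.
rewrite bigcup_mkcond; apply: countable_bigcupT_measurable => [|p].
  exact: countableP.
case: ifPn => // _.
have k0 : 0 < k.+1%:R :> R by [].
rewrite (_ : [set y | _] = \bigcap_(j in [set: 'I_N])
   ((fun y : N.-tuple R => tnth y j) @^-1`
      `[(p j)%:~R / k.+1%:R, (p j + 1)%:~R / k.+1%:R[)).
  apply: fin_bigcap_measurable => // j _; rewrite -[X in measurable X]setTI.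
  by apply: measurable_tnth => //; exact: measurable_itv.
have E (j : 'I_N) (y : N.-tuple R) : (tnth y j \in
    `[(p j)%:~R / k.+1%:R, (p j + 1)%:~R / k.+1%:R[) =
    (Num.floor (k.+1%:R * tnth y j) == p j).
  by rewrite in_itv/= floor_eq ler_pdivrMr// ltr_pdivlMr// [tnth y j * _]mulrC.
apply/seteqP; split => y /=.
  by move=> zp j _; have := E j y; rewrite -{3}zp ffunE eqxx.
by move=> Hy; apply/ffunP => j; rewrite ffunE; apply/eqP; rewrite -E;
    exact: (Hy j I).
Unshelve. all: by end_near.
Qed.
End Measurability.

Section FubiniTuples.
Context {R : realType}.
Local Notation mu := (@lebesgue_measure R).

Definition cube N (r : R) : set (N.-tuple R) :=
  [set y | forall j, `|tnth y j| <= r].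

Lemma measurable_cube N r : measurable (@cube N r).
Proof.
rewrite (_ : cube r = \bigcap_(j in [set: 'I_N])
   ((fun y : N.-tuple R => tnth y j) @^-1` `[- r, r])).
  apply: fin_bigcap_measurable => // j _; rewrite -[X in measurable X]setTI.
  by apply: measurable_tnth => //; exact: measurable_itv.
have E (t : R) : (t \in `[- r, r]) = (`|t| <= r) by rewrite in_itv/= ler_norml.
apply/seteqP; split => y Hy j; first by move=> _; have := E (tnth y j);
    rewrite Hy.
by have := Hy j I; rewrite /preimage/= E.
Qed.

Lemma lebesgueN_cube_lty N r : (lebesgueN N (cube r) < +oo)%E.
Proof.
elim: N => [|N IH]; first by rewrite /= diracE ltry.
rewrite lebesgueNS.
rewrite (_ : _ @^-1` _ = cube r `*` `[- r, r]).
  rewrite product_measure1E//=; last exact: measurable_cube.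
  by rewrite lte_mul_pinfty// ?ge0_fin_numE//= lebesgue_measure_itv; case: ifP;
      rewrite ltry.
have E (t : R) : (t \in `[- r, r]) = (`|t| <= r) by rewrite in_itv/= ler_norml.
apply/seteqP; split => -[y x] /=.
  move=> H; split => /=; last by rewrite E; exact: (H ord0).
  by move=> j; have := H (lift ord0 j); rewrite tnthS.
move=> [Hy] /=; rewrite E => Hx j.
by case: (unliftP ord0 j) => [k ->|->]; rewrite ?tnthS//; exact: Hy.
Qed.

Lemma lebesgueN_sigma_finite N : sigma_finite setT (@lebesgueN R N).
Proof.
exists (fun k => cube k%:R); last first.
  by move=> k; split; [exact: measurable_cube|exact: lebesgueN_cube_lty].
apply/esym/seteqP; split => // y _.
have [k Hk] : exists k : nat, forall j, `|tnth y j| <= k%:R.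
  exists (\max_(j < N) (Num.trunc `|tnth y j|).+1)%N => j.
  apply: (@le_trans _ _ (Num.trunc `|tnth y j|).+1%:R).
    by rewrite ltW// truncnS_gt.
  by rewrite ler_nat (@leq_bigmax _ (fun j => (Num.trunc `|tnth y j|).+1) j).
by exists k.
Qed.

(** The constant under which lebesgueN is registered as a sigma-finite measure:
    Fubini's theorem needs the instance, which cannot be attached to
    lebesgueN, an inhabitant of the type of measures. *)
Definition lebN N : set (N.-tuple R) -> \bar R := lebesgueN N.
HB.instance Definition _ N := Measure.copy (@lebN N)
    (Measure.sort (@lebesgueN R N)).
HB.instance Definition _ N :=
  @Measure_isSigmaFinite.Build _ _ _ (@lebN N) (@lebesgueN_sigma_finite N).

Lemma lebNE N : Measure.sort (@lebesgueN R N) = @lebN N.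
Proof. exact: erefl. Qed.

Local Open Scope ereal_scope.

Lemma tonelli_head N (f : N.+1.-tuple R -> \bar R) :
  measurable_fun [set: N.+1.-tuple R] f -> (forall y, 0 <= f y) ->
  \int[lebN (N:=N.+1)]_y f y =
  \int[lebN (N:=N)]_y \int[mu]_x f (tuple_cons (y, x)).
Proof.
move=> mf f0.
rewrite -[LHS]/(\int[pushforward (lebN (N:=N) \x mu) (@tuple_cons R N)]_y f y).
rewrite ge0_integral_pushforward//; last exact: measurable_tuple_cons.
rewrite fubini_tonelli1//; last first.
  by move=> z; exact: f0.
by apply: measurableT_comp => //; exact: measurable_tuple_cons.
Qed.

Lemma integrable_head N (f : N.+1.-tuple R -> \bar R) :
  (lebN (N:=N.+1)).-integrable [set: N.+1.-tuple R] f ->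
  (lebN (N:=N) \x mu).-integrable [set: N.-tuple R * R] (f \o @tuple_cons R N).
Proof.
move=> /integrableP[mf fi]; apply/integrableP; split.
  by apply: measurableT_comp => //; exact: measurable_tuple_cons.
rewrite fubini_tonelli1//=; last first.
  by apply: measurableT_comp => //; apply: measurableT_comp => //;
      exact: measurable_tuple_cons.
by move: fi; rewrite tonelli_head//; exact: measurableT_comp.
Qed.

Lemma fubini_head N (f : N.+1.-tuple R -> \bar R) :
  (lebN (N:=N.+1)).-integrable [set: N.+1.-tuple R] f ->
  \int[lebN (N:=N.+1)]_y f y =
  \int[lebN (N:=N)]_y \int[mu]_x f (tuple_cons (y, x)).
Proof.
move=> fi; have fi' := integrable_head fi; move/integrableP : fi => [mf _].
rewrite -[LHS]/(\int[pushforward (lebN (N:=N) \x mu) (@tuple_cons R N)]_y f y).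
rewrite integral_pushforward//; last exact: measurable_tuple_cons.
by rewrite -integral12_prod_meas1.
Qed.

Lemma fubini_tail N (f : N.+1.-tuple R -> \bar R) :
  (lebN (N:=N.+1)).-integrable [set: N.+1.-tuple R] f ->
  \int[lebN (N:=N.+1)]_y f y =
  \int[mu]_x \int[lebN (N:=N)]_y f (tuple_cons (y, x)).
Proof.
move=> fi; have fi' := integrable_head fi; move/integrableP : fi => [mf _].
rewrite -[LHS]/(\int[pushforward (lebN (N:=N) \x mu) (@tuple_cons R N)]_y f y).
rewrite integral_pushforward//; last exact: measurable_tuple_cons.
by rewrite -integral21_prod_meas1.
Qed.
End FubiniTuples.

Section LineIntegrals.
Context {R : realType}.
Local Notation mu := (@lebesgue_measure R).

Definition update N (j : 'I_N) (s : R) (y : N.-tuple R) : N.-tuple R :=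
  [tuple if i == j then s else tnth y i | i < N].

Lemma update_head N s (x : R) (y : N.-tuple R) :
  update ord0 s (tuple_cons (y, x)) = tuple_cons (y, s).
Proof.
apply: eq_from_tnth => i; rewrite tnth_mktuple.
by case: (unliftP ord0 i) => [k ->|->]; rewrite ?eqxx//= !tnthS.
Qed.

Lemma update_tail N (k : 'I_N) s (x : R) (y : N.-tuple R) :
  update (lift ord0 k) s (tuple_cons (y, x)) = tuple_cons (update k s y, x).
Proof.
apply: eq_from_tnth => i; rewrite tnth_mktuple.
case: (unliftP ord0 i) => [l ->|->]//=; rewrite !tnthS tnth_mktuple.
by rewrite (inj_eq lift_inj).
Qed.

Lemma integrable_bounded N (D : set (N.-tuple R)) (f : N.-tuple R -> R) r M :
  measurable D -> D `<=` cube r -> measurable_fun D f ->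
  (forall y, D y -> `|f y| <= M) -> (lebesgueN N).-integrable D (EFin \o f).
Proof.
move=> mD Dr mf fM; apply: measurable_bounded_integrable => //.
  apply: le_lt_trans (lebesgueN_cube_lty N r).
  by apply: le_measure => //; rewrite inE//; exact: measurable_cube.
exists M; split; first exact: num_real.
by move=> c Mc y Dy; apply: le_trans (ltW Mc); exact: fM.
Qed.

Lemma integrable_lebN N (D : set (N.-tuple R)) (f : N.-tuple R -> \bar R) :
  (lebesgueN N).-integrable D f <-> (lebN (N:=N)).-integrable D f.
Proof. by split=> /integrableP[mf fi]; apply/integrableP. Qed.

(** Fubini's theorem in the form used below: the integral over the whole space
    vanishes as soon as the integrals over all lines parallel to one axis do.
    The recursion peels off the head coordinate; if the axis is another one,
    the induction hypothesis applies to the slices. *)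
Lemma integral_lines0 N (j : 'I_N) (f : N.-tuple R -> R) r M :
  measurable_fun [set: N.-tuple R] f -> (forall y, `|f y| <= M) ->
  (forall y, ~ cube r y -> f y = 0) ->
  (forall y, \int[mu]_s (f (update j s y))%:E = 0)%E ->
  (\int[lebesgueN N]_y (f y)%:E = 0)%E.
Proof.
elim: N j f => [|N IH] j f; first by case: j.
move=> mf fM f0 fl.
have fi : (lebN (N:=N.+1)).-integrable [set: N.+1.-tuple R] (EFin \o f).
  have -> : EFin \o f = (EFin \o f) \_ (cube r).
    apply/funext => y; rewrite patchE/=.
    by case: ifPn => // /negP; rewrite inE => /f0 ->.
  have mC : measurable (cube r : set (N.+1.-tuple R)) :=
      @measurable_cube R N.+1 r.
  apply/(integrable_mkcond (EFin \o f) mC)/(@integrable_lebN N.+1 (cube r)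
      (EFin \o f)).
  apply: (integrable_bounded (r:=r) (M:=M) mC) => //.
  exact: measurable_funTS.
rewrite -[LHS]/(\int[lebN (N:=N.+1)]_y (EFin \o f) y)%E.
case: (unliftP ord0 j) => [k jk|j0].
  rewrite fubini_tail// integral0_eq// => x _ /=.
  apply: (IH k (fun y => f (tuple_cons (y, x)))) => //.
  - apply: measurableT_comp => //.
    by apply: measurableT_comp;
        [exact: measurable_tuple_cons|exact: measurable_pair2].
  - move=> y yr; apply: f0 => H; apply: yr => i.
    by have := H (lift ord0 i); rewrite tnthS.
  - move=> y; rewrite -(fl (tuple_cons (y, x))) jk.
    by under [RHS]eq_integral do rewrite update_tail.
rewrite fubini_head// integral0_eq// => y _ /=.
rewrite -(fl (tuple_cons (y, 0))) j0.
by under [RHS]eq_integral do rewrite update_head.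
Qed.
End LineIntegrals.

Section Dilations.
Context {R : realType}.
Local Notation mu := (@lebesgue_measure R).

(** c times the image of the Lebesgue measure under x |-> c x agrees with the
    Lebesgue measure on intervals. *)
Lemma integral_dilation1 (c : R) (f : R -> \bar R) : 0 < c ->
  measurable_fun [set: R] f -> (forall x, 0 <= f x)%E ->
  (\int[mu]_x f x = c%:E * \int[mu]_x f (c * x)%R)%E.
Proof.
move=> c0 mf f0.
have mc : measurable_fun [set: measurableTypeR R] (fun x : measurableTypeR R =>
    (c * x : measurableTypeR R)).
  exact: mulrl_measurable.
pose m' := mscale (NngNum (ltW c0)) (image_measure mu mc).
transitivity (\int[m']_x f x)%E.
  apply: eq_measure_integral => A mA _; apply: lebesgue_measure_unique => //.
  move=> _ /ocitvP[->|[[a b]/= ab ->]]; first by rewrite !measure0.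
  rewrite /m' /mscale/= /image_measure/= /pushforward.
  rewrite (_ : _ @^-1` _ = `]c^-1 * a, c^-1 * b]%classic); last first.
    have E x : (c * x \in `]a, b]) = (x \in `]c^-1 * a, c^-1 * b]).
      by rewrite !in_itv/= ltr_pdivrMl// ler_pdivlMl.
    by apply/seteqP; split => x /=; rewrite E.
  rewrite !lebesgue_measure_itv/= !lte_fin ltr_pM2l ?invr_gt0// ab.
  by rewrite -!EFinD -EFinM -mulrBr mulrA divff ?gt_eqF// mul1r.
rewrite ge0_integral_mscale//; congr (_ * _)%E.
by rewrite /image_measure/= ge0_integral_pushforward.
Qed.

Lemma scaleE N (c : R) (y : N.-tuple R) i : tnth (scale c y) i = c * tnth y i.
Proof. by rewrite tnth_mktuple. Qed.

Lemma scale_cons N (c x : R) (y : N.-tuple R) :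
  scale c (tuple_cons (y, x)) = tuple_cons (scale c y, c * x).
Proof.
apply: eq_from_tnth => i; rewrite scaleE.
by case: (unliftP ord0 i) => [k ->|->]; rewrite //= !tnthS scaleE.
Qed.

Lemma measurable_scale N d (T : measurableType d) (c : T -> R) (g : T ->
    N.-tuple R) :
  measurable_fun [set: T] c -> measurable_fun [set: T] g ->
  measurable_fun [set: T] (fun y => scale (c y) (g y)).
Proof.
move=> mc mg; apply/measurable_fun_tnthP => i.
rewrite (_ : _ \o _ = (fun y => c y * tnth (g y) i)); last first.
  by apply/funext => y /=; rewrite scaleE.
apply: measurable_funM => //.
by apply: (measurableT_comp (measurable_tnth i)).
Qed.

Lemma integral_dilation N (c : R) (f : N.-tuple R -> \bar R) : 0 < c ->
  measurable_fun [set: N.-tuple R] f -> (forall x, 0 <= f x)%E ->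
  (\int[lebesgueN N]_y f y = (c ^+ N)%:E * \int[lebesgueN N]_y f (scale c y))%E.
Proof.
move=> c0; elim: N f => [|N IH] f mf f0.
  rewrite /= expr0 mul1e; apply: eq_integral => y _; congr f.
  by apply: eq_from_tnth => -[].
have msc : measurable_fun [set: N.+1.-tuple R] (fun y => f (scale c y)).
  by apply: measurableT_comp => //; apply: measurable_scale.
have mcons (y : N.-tuple R) : measurable_fun [set: R] (fun x =>
    f (tuple_cons (y, x))).
  apply: measurableT_comp => //.
  by apply: measurableT_comp;
      [exact: measurable_tuple_cons|exact: measurable_pair1].
rewrite lebNE (tonelli_head mf f0) (tonelli_head msc)// -lebNE.
under eq_integral => y _ do rewrite (integral_dilation1 c0 (mcons y) (fun x =>
    f0 _)).
have mF : measurable_fun [set: N.-tuple R] (fun y =>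
    \int[mu]_x f (tuple_cons (y, (c * x)%R)))%E.
  pose g (z : N.-tuple R * R) := f (tuple_cons (z.1, c * z.2)).
  suff mg : measurable_fun [set: N.-tuple R * R] g.
    by have := @measurable_fun_fubini_tonelli_F _ _ _ _ R mu g mg (fun z =>
        f0 _).
  apply: measurableT_comp => //; apply: measurableT_comp;
      first exact: measurable_tuple_cons.
  apply: measurable_fun_pair => //.
  by apply: measurable_funM.
rewrite ge0_integralZl//; last 2 first.
- by move=> y _; exact: integral_ge0.
- by rewrite lee_fin ltW.
rewrite (IH _ mF); last by move=> y; exact: integral_ge0.
rewrite muleA -EFinM exprS; congr (_ * _)%E.  apply: eq_integral => y _ /=.
by apply: eq_integral => x _; rewrite scale_cons.
Qed.
End Dilations.

Section Balls.
Context {R : realType}.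

Lemma enorm_ge0 N (y : N.-tuple R) : 0 <= enorm y.
Proof. exact: sqrtr_ge0. Qed.

Lemma enorm_sqr N (y : N.-tuple R) : enorm y ^+ 2 = \sum_(j < N) tnth y j ^+ 2.
Proof. by rewrite sqr_sqrtr// sumr_ge0// => j _; exact: sqr_ge0. Qed.

Lemma tnth_le_enorm N (y : N.-tuple R) j : `|tnth y j| <= enorm y.
Proof.
rewrite -sqrtr_sqr ler_wsqrtr// (bigD1 j)//= lerDl.
by apply: sumr_ge0 => i _; exact: sqr_ge0.
Qed.

Lemma enorm_scale N c (y : N.-tuple R) : enorm (scale c y) = `|c| * enorm y.
Proof.
rewrite /enorm -sqrtr_sqr -sqrtrM ?sqr_ge0// mulr_sumr; congr Num.sqrt.
by apply: eq_bigr => j _; rewrite scaleE exprMn.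
Qed.

Lemma eball_cube N (r : R) : eball r `<=` @cube R N r.
Proof. by move=> y yr j; rewrite (le_trans (tnth_le_enorm _ _))// ltW. Qed.

Lemma enorm_row N (y : N.-tuple R) :
  enorm y = Num.sqrt (\sum_(j < N) (row_of y) 0 j ^+ 2).
Proof. by congr Num.sqrt; apply: eq_bigr => j _; rewrite mxE. Qed.

Lemma measurable_enorm N : measurable_fun [set: N.-tuple R] (@enorm R N).
Proof.
rewrite (_ : @enorm R N = (fun y =>
    Num.sqrt (\sum_(j < N) (row_of y) 0 j ^+ 2))); last first.
  by apply/funext => y; rewrite enorm_row.
apply: (@measurable_continuous_row R N (fun v =>
    Num.sqrt (\sum_(j < N) v 0 j ^+ 2))).
move=> v; apply: (@continuous_comp _ _ _ (fun v : 'rV[R]_N =>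
    \sum_(j < N) v 0 j ^+ 2) (@Num.sqrt R)); last exact: sqrt_continuous.
apply: continuous_sum => j;
    apply: (@continuous_comp _ _ _ (fun v : 'rV[R]_N => v 0 j) (fun x : R =>
    x ^+ 2)).
  exact: coord_continuous.
exact: exprn_continuous.
Qed.

Lemma measurable_eball N (r : R) : measurable (eball r : set (N.-tuple R)).
Proof.
rewrite (_ : eball r = @enorm R N @^-1` `]-oo, r[).
  by rewrite -[X in measurable X]setTI; apply: measurable_enorm => //;
      exact: measurable_itv.
by apply/seteqP; split => y /=; rewrite in_itv.
Qed.

Lemma integrable_eball N r (f : N.-tuple R -> R) M :
  measurable_fun (eball r) f -> (forall y, eball r y -> `|f y| <= M) ->
  (lebesgueN N).-integrable (eball r) (EFin \o f).
Proof.
move=> mf fM; apply: integrable_bounded fM => //; last exact: eball_cube.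
exact: measurable_eball.
Qed.

Lemma ball_integral_dilation N r (f : N.-tuple R -> R) M : 0 < r ->
  measurable_fun [set: N.-tuple R] f -> (forall y, eball r y -> `|f y| <= M) ->
  ball_integral r f = r ^+ N * ball_integral 1 (fun y => f (scale r y)).
Proof.
move=> r0 mf fM.
have fi : (lebesgueN N).-integrable (eball r) (EFin \o f).
  by apply: integrable_eball fM; exact: measurable_funTS.
have msc : measurable_fun [set: N.-tuple R] (scale r : N.-tuple R ->
    N.-tuple R).
  exact: measurable_scale.
have Esc (y : N.-tuple R) : (scale r y \in eball r) = (y \in eball 1).
  by apply/idP/idP; rewrite !inE /eball/= enorm_scale gtr0_norm// -{2}(mulr1 r)
      ltr_pM2l.
have gi : (lebesgueN N).-integrable (eball 1) (EFin \o (fun y =>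
    f (scale r y))).
  apply: (@integrable_eball _ _ _ M); first by apply: measurable_funTS;
      exact: measurableT_comp.
  by move=> y y1; apply: fM; apply/set_mem; rewrite Esc; exact/mem_set.
rewrite /ball_integral /Rintegral -[r ^+ N]/(fine (r ^+ N)%:E) -fineM//;
    last first.
  have mB := @measurable_eball N 1.
  have := integrable_fin_num mB gi.
  by [].
congr fine.
have mBr := @measurable_eball N r.
have pos (h : R -> \bar R) : h 0 = 0%E -> (forall x, 0 <= h x)%E ->
    measurable_fun [set: R] h ->
  (\int[lebesgueN N]_(y in eball r) h (f y) =
   (r ^+ N)%:E * \int[lebesgueN N]_(y in eball 1) h (f (scale r y)))%E.
  move=> h0 hp mh; rewrite integral_mkcond [X in (_ * X)%E]integral_mkcond.
  rewrite (integral_dilation r0).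
  - congr (_ * _)%E; apply: eq_integral => y _.
    by rewrite !patchE Esc.
  - apply: (measurable_restrictT _ mBr).1; apply: measurable_funTS.
    exact: (measurableT_comp mh mf).
  - by move=> y; rewrite patchE; case: ifP.
have posE : (\int[lebesgueN N]_(y in eball r) (EFin \o f)^\+ y =
   (r ^+ N)%:E * \int[lebesgueN N]_(y in eball 1) (EFin \o (fun y =>
       f (scale r y)))^\+ y)%E.
  have h1 x : (0 <= maxe x%:E 0 :> \bar R)%E by rewrite le_max lexx orbT.
  have h2 : measurable_fun [set: R] (fun x => maxe x%:E 0)%E.
    by apply: measurable_maxe => //; exact/measurable_EFinP.
  have h0 : maxe 0%:E 0 = 0%E :> \bar R by rewrite maxxx.
  by rewrite funepos.unlock; exact: (pos (fun x => maxe x%:E 0)%E h0 h1 h2).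
have negE : (\int[lebesgueN N]_(y in eball r) (EFin \o f)^\- y =
   (r ^+ N)%:E * \int[lebesgueN N]_(y in eball 1) (EFin \o (fun y =>
       f (scale r y)))^\- y)%E.
  have h0 : (maxe (- 0%:E) 0 = 0 :> \bar R)%E by rewrite oppe0 maxxx.
  have h1 x : (0 <= maxe (- x%:E) 0 :> \bar R)%E by rewrite le_max lexx orbT.
  have h2 : measurable_fun [set: R] (fun x => maxe (- x%:E) 0)%E.
    apply: measurable_maxe => //;
        rewrite -[X in measurable_fun _ X]/(EFin \o -%R).
    by apply/measurable_EFinP; apply: continuous_measurable_fun;
        exact: opp_continuous.
  by rewrite funeneg.unlock; exact: (pos (fun x => maxe (- x%:E) 0)%E h0 h1 h2).
rewrite integralE [in RHS]integralE posE negE.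
rewrite -muleBr//; apply: fin_num_adde_defl; rewrite fin_numN.
have mB1 := @measurable_eball N 1.
have := integrable_neg_fin_num mB1 gi.
by [].
Qed.
End Balls.

(** * Integrals of derivatives of compactly supported functions *)

Section FundamentalTheorem.
Context {R : realType}.
Local Notation mu := (@lebesgue_measure R).

Lemma bounded_on_cube N (f : 'rV[R]_N -> R) (r : R) : continuous f ->
  exists2 M, 0 <= M & forall v : 'rV[R]_N, (forall j, `|v 0 j| <= r) ->
      `|f v| <= M.
Proof.
move=> cf; pose A := [set v : 'rV[R]_N | forall j, `[- r, r]%classic (v 0 j)].
have E (t : R) : (t \in `[- r, r]) = (`|t| <= r) by rewrite in_itv/= ler_norml.
have cA : compact A.
  by have := @rV_compact R N (fun=> `[- r, r]%classic) (fun _ =>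
      @segment_compact _ _ _).
have [A0|A0] := pselect (A !=set0).
  have cn : continuous (fun v : 'rV[R]_N => `|f v|).
    by move=> v; apply: (@continuous_comp _ _ _ f Num.norm);
        [exact: cf|exact: norm_continuous].
  have cn' : {within A, continuous (fun v : 'rV[R]_N => `|f v|)}.
    exact: (continuous_subspaceT cn).
  have [c _ Hc] := compact_EVT_max A0 cA cn'.
  exists `|f c| => // v vr; apply: Hc; apply/mem_set => j /=.
  by rewrite E.
exists 0 => // v vr; exfalso; apply: A0; exists v => j /=.
by rewrite E.
Qed.

Lemma row_of_update N (j : 'I_N) s (y : N.-tuple R) :
  row_of (update j s y) = row_of (update j 0 y) + s *: delta_mx 0 j.
Proof.
apply/rowP => i; rewrite !mxE !tnth_mktuple eqxx/=.
by case: eqP => _; rewrite ?mulr1 ?add0r// mulr0 addr0.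
Qed.

(** Fundamental theorem of calculus on [-a, a]: both g(a) and g(- a) are 0. *)
Lemma integral_derive_line (g dg : R -> R) (a : R) : 0 < a ->
  (forall s : R, is_derive s 1 g (dg s)) -> continuous dg ->
  (forall s, a <= `|s| -> g s = 0 /\ dg s = 0) ->
  (\int[mu]_s (dg s)%:E = 0)%E.
Proof.
move=> a0 gd cdg g0.
have E (t : R) : (t \in `[- a, a]) = (`|t| <= a) by rewrite in_itv/= ler_norml.
transitivity (\int[mu]_(s in `[(- a)%R, a]) (dg s)%:E)%E.
  rewrite [RHS]integral_mkcond; apply: eq_integral => s _.
  rewrite patchE; case: ifPn => //; rewrite notin_setE/= E => /negP.
  by rewrite -ltNge => /ltW/g0[_ ->].
have dga s : derivable g s 1 by have [] := gd s.
have cg : continuous g.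
  by move=> s; apply: differentiable_continuous; exact/derivable1_diffP.
have aa : a <= `|a| by rewrite gtr0_norm.
have aNa : a <= `|- a| by rewrite normrN.
rewrite (@continuous_FTC2 _ dg g).
- by rewrite (g0 a aa).1 (g0 (- a) aNa).1 sube0.
- by lra.
- exact: continuous_subspaceT.
- split; first by move=> s _.
  + exact/cvg_at_right_filter/cg.
  + exact/cvg_at_left_filter/cg.
- by move=> s _; rewrite derive1E; have [_ ->] := gd s.
Qed.
End FundamentalTheorem.

Section CompactSupport.
Context {R : realType}.

Definition sqn N (v : 'rV[R]_N) : R := \sum_(j < N) v 0 j ^+ 2.

Lemma sqn_ge0 N (v : 'rV[R]_N) : 0 <= sqn v.
Proof. by apply: sumr_ge0 => j _; exact: sqr_ge0. Qed.

Lemma coord_sqn N (v : 'rV[R]_N) j : v 0 j ^+ 2 <= sqn v.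
Proof.
by rewrite /sqn (bigD1 j)//= lerDl sumr_ge0// => i _; exact: sqr_ge0.
Qed.

Lemma C1_sqn N : C1 (@sqn N).
Proof.
apply: C1_sum => j; rewrite (_ : (fun v : 'rV[R]_N => _) = (fun v =>
    v 0 j * v 0 j)).
  by apply: C1M; exact: C1_coord.
by apply/funext => v; rewrite expr2.
Qed.

Lemma sqn_row N (y : N.-tuple R) : sqn (row_of y) = enorm y ^+ 2.
Proof. by rewrite enorm_sqr; apply: eq_bigr => j _; rewrite mxE. Qed.

Lemma partial_outside_ball N (phi : 'rV[R]_N -> R) j v :
  (forall w, 1 <= sqn w -> phi w = 0) -> 1 < sqn v -> partial j phi v = 0.
Proof.
move=> phi0 v1; rewrite /partial -(derive_cst (0 : R) v (delta_mx 0 j)).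
have e0 : delta_mx 0 j != 0 :> 'rV[R]_N.
  by apply/eqP => /rowP/(_ j)/eqP; rewrite !mxE !eqxx oner_eq0.
apply: near_eq_derive => //.
have cs : @sqn N w @[w --> v] --> sqn v by apply: C1_continuous; exact: C1_sqn.
have H : \forall w \near v, 1 < sqn w by exact: (cvgr_gt _ cs _ v1).
by apply: (@filterS _ (nbhs v) _ _ _ _ H) => w /= /ltW/phi0.
Qed.

Lemma integral_partial0 N (phi : 'rV[R]_N -> R) j : C1 phi ->
  (forall v, 1 <= sqn v -> phi v = 0) ->
  (\int[lebesgueN N]_y (partial j phi (row_of y))%:E = 0)%E.
Proof.
move=> [dphi cphi] phi0.
have [M M0 HM] := bounded_on_cube 1 (cphi j).
have out y : ~ cube 1 y -> partial j phi (row_of y) = 0.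
  move=> y1; apply: partial_outside_ball => //; rewrite ltNge; apply/negP => H.
  apply: y1 => i; have := le_trans (coord_sqn (row_of y) i) H.
  by rewrite mxE -[X in _ <= X](expr1n _ 2) -[X in X <= _]real_normK
      ?num_real// ler_sqr ?nnegrE.
apply: (@integral_lines0 _ _ j _ 1 M) => //.
- exact: measurable_continuous_row.
- move=> y; have [y1|y1] := pselect (cube 1 y); last by rewrite out// normr0.
  by apply: HM => i; rewrite mxE; exact: y1.
move=> y; pose x := row_of (update j 0 y).
have xj (s : R) : (x + s *: delta_mx 0 j) 0 j = s.
  by rewrite !mxE tnth_mktuple eqxx/= mulr1 add0r.
under eq_integral => s _ do rewrite row_of_update -/x.
apply: (@integral_derive_line _ (fun s : R =>
    phi (x + s *: delta_mx 0 j)) (fun s : R =>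
    partial j phi (x + s *: delta_mx 0 j)) 2) => //.
- by move=> s; apply: (is_derive_lineP _ _ _ _ _).1;
    exact/derivableP/diff_derivable.
- move=> s; apply: (@continuous_comp _ _ _ (fun s : R =>
    x + s *: delta_mx 0 j) (partial j phi)); last exact: cphi.
  apply: continuousD; first exact: cst_continuous.
  by apply: continuousZl; exact: cvg_id.
- move=> s s2; have H : 1 < sqn (x + s *: delta_mx 0 j).
    apply: lt_le_trans (coord_sqn _ j); rewrite xj -real_normK ?num_real//.
    by have := normr_ge0 s; nra.
  by split; [apply/phi0/ltW|exact: partial_outside_ball].
Qed.
End CompactSupport.

(** * A cutoff function on the line *)

Section Cutoff.
Context {R : realType}.

(** A remainder bounded by C h^2 spares the case analysis that the kink of the
    derivative of Num.max s 0 ^+ 2 at 0 would require. *)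
Lemma is_derive_quadratic (f : R -> R) x l C :
  (forall h, `|f (h + x) - f x - h * l| <= C * h ^+ 2) -> is_derive x 1 f l.
Proof.
move=> fC; have C0 : 0 <= C.
  by have := fC 1; rewrite expr1n mulr1; apply: le_trans.
suff L : h^-1 *: (f (h *: 1 + x) - f x) @[h --> 0^'] --> l.
  split; first by apply/cvg_ex; exists l.
  exact: cvg_lim L.
apply/cvgrPdist_le => e e0.
have e'0 : 0 < e / (C + 1) by rewrite divr_gt0// ltr_wpDl.
near=> h.
have h0 : h != 0 by near: h; exact: nbhs_dnbhs_neq.
have he : `|h| <= e / (C + 1) by near: h; apply: dnbhs0_le.
rewrite -[h *: 1]/(h * 1) mulr1 -[X in l - X]/(h^-1 * _).
rewrite (_ : l - _ = - (h^-1 * (f (h + x) - f x - h * l))); last first.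
  by rewrite [in RHS]mulrBr mulKf//; ring.
rewrite normrN normrM normfV ler_pdivrMl ?normr_gt0//.
apply: le_trans (fC h) _;
    rewrite -real_normK ?num_real// expr2 mulrCA ler_wpM2l//.
have : C * `|h| <= C * (e / (C + 1)) by rewrite ler_wpM2l.
move=> /le_trans; apply; rewrite mulrCA ger_pMr// ler_pdivrMr; lra.
Unshelve. all: by end_near. Qed.

(** Equal to 0 on ]-oo, 0], of class C1, and tending to 1 at +oo; being
    rational on [0, +oo[ it has explicit bounds. *)
Definition cutoff (s : R) : R := 1 - (1 + Num.max s 0 ^+ 2)^-1.

Definition dcutoff (s : R) : R := 2 * Num.max s 0 / (1 + Num.max s 0 ^+ 2) ^+ 2.

Lemma is_derive_cutoff (s : R) : is_derive s 1 cutoff (dcutoff s).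
Proof.
have H : is_derive s 1 (fun s => Num.max s 0 ^+ 2) (2 * Num.max s 0).
  apply: (@is_derive_quadratic _ _ _ 1) => h; rewrite mul1r ler_norml.
  by rewrite /Num.max; case: ltP => h1; case: ltP => h2; apply/andP; split; nra.
have H1 : is_derive s 1 (fun s : R =>
    1 + Num.max s 0 ^+ 2) (0 + 2 * Num.max s 0).
  by apply: is_deriveD; exact: is_derive_cst.
have N0 : 1 + Num.max s 0 ^+ 2 != 0 by rewrite gt_eqF// ltr_pwDl// sqr_ge0.
have H2 := @is_deriveV _ (fun s : R => 1 + Num.max s 0 ^+ 2) _ _ _ N0 H1.
have H3 : is_derive s 1 cutoff (0 - (- (1 + Num.max s 0 ^+ 2) ^- 2 *: (0 + 2 *
    Num.max s 0))).
  by apply: is_deriveB; exact: is_derive_cst.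
apply: is_derive_eq H3 _; rewrite /dcutoff /= sub0r add0r scaleNr opprK.
by rewrite -[_ *: _]/(_ * _) mulrC.
Qed.

Lemma continuous_dcutoff : continuous dcutoff.
Proof.
move=> s; have cm : {for s, continuous (fun s : R => Num.max s 0)}.
  exact: (@continuous_max _ _ id (cst 0) s (@cvg_id _ _)
      (@cst_continuous _ _ _ _)).
have cq : {for s, continuous (fun s : R => (1 + Num.max s 0 ^+ 2) ^+ 2)}.
  apply: (@continuous_comp _ _ _ (fun s : R => 1 + Num.max s 0 ^+ 2) (fun x =>
      x ^+ 2)); last exact: exprn_continuous.
  apply: continuousD; first exact: cst_continuous.
  by apply: (@continuous_comp _ _ _ (fun s : R => Num.max s 0) (fun x =>
      x ^+ 2)); last exact: exprn_continuous.
have c1 : {for s, continuous (fun s : R => 2 * Num.max s 0)}.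
  by apply: (@continuousM _ _ (cst 2) (fun s : R => Num.max s 0));
      first exact: cst_continuous.
have c2 : {for s, continuous (fun s : R => ((1 + Num.max s 0 ^+ 2) ^+ 2)^-1)}.
  apply: (@continuousV _ _ (fun s : R => (1 + Num.max s 0 ^+ 2) ^+ 2)) => //.
  by rewrite gt_eqF// exprn_gt0// ltr_pwDl// sqr_ge0.
exact: (continuousM c1 c2).
Qed.

Lemma cutoff_le0 (s : R) : s <= 0 -> cutoff s = 0.
Proof. by move=> s0; rewrite /cutoff max_r// expr0n/= addr0 invr1 subrr. Qed.

Lemma dcutoff_le0 (s : R) : s <= 0 -> dcutoff s = 0.
Proof. by move=> s0; rewrite /dcutoff max_r// mulr0 mul0r. Qed.

Lemma cutoff_itv (s : R) : 0 <= cutoff s <= 1.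
Proof.
have H : 1 <= 1 + Num.max s 0 ^+ 2 by rewrite lerDl sqr_ge0.
rewrite /cutoff subr_ge0 gerBl invr_ge0 (le_trans _ H)// andbT.
by rewrite invf_le1// (lt_le_trans _ H).
Qed.

(** The bound that makes k * dcutoff (k s) * s both dominated and convergent to
    0 when k grows. *)
Lemma dcutoff_bound (s : R) : 0 <= s ->
    0 <= s * dcutoff s <= 2 * (1 + s ^+ 2)^-1.
Proof.
move=> s0; rewrite /dcutoff max_l//;
    have h : 0 < 1 + s ^+ 2 by rewrite ltr_pwDl// sqr_ge0.
apply/andP; split; first by rewrite !mulr_ge0// invr_ge0 ltW// exprn_gt0.
rewrite mulrA ler_pdivrMr ?exprn_gt0//.
rewrite (_ : 2 * _ * _ = 2 * (1 + s ^+ 2)); first nra.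
by rewrite expr2 -mulrA mulKf// gt_eqF.
Qed.

Lemma cvg_inv_sqr (s : R) : 0 < s ->
    (1 + (k.+1%:R * s) ^+ 2)^-1 @[k --> \oo] --> 0.
Proof.
move=> s0; apply: (@squeeze_cvgr _ _ _ _ (cst 0) (fun k => s^-1 * k.+1%:R^-1)).
- near=> k; set x := k.+1%:R * s; have x0 : 0 < x by rewrite mulr_gt0.
  have h : 0 < 1 + x ^+ 2 by rewrite ltr_pwDl// sqr_ge0.
  rewrite invr_ge0 ltW//= -invfM [s * _]mulrC -/x lef_pV2 ?posrE//.
  have : 0 <= (x - 1) ^+ 2 by exact: sqr_ge0.
  by rewrite sqrrB1 => ?; lra.
- exact: cvg_cst.
- rewrite -[X in _ --> X](mulr0 s^-1).
  by apply: cvgMr; exact: cvg_harmonic.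
Unshelve. all: by end_near. Qed.

Lemma cvg_cutoff (s : R) : 0 < s ->
    cutoff (k.+1%:R * s) @[k --> \oo] --> (1 : R).
Proof.
move=> s0.
rewrite (_ : (fun k => _) = (fun k => 1 - (1 + (k.+1%:R * s) ^+ 2)^-1));
    last first.
  by apply/funext => k; rewrite /cutoff max_l// mulr_ge0// ltW.
suff : 1 - (1 + (k.+1%:R * s) ^+ 2)^-1 @[k --> \oo] --> (1 - 0 : R) by rewrite
    subr0.
by apply: cvgB; [exact: cvg_cst|exact: cvg_inv_sqr].
Qed.
End Cutoff.

(** * Fields tangent to the unit sphere *)

Section BallIntegrals.
Context {R : realType}.

Lemma integrable_continuous_row N (r : R) (g : 'rV[R]_N -> R) : continuous g ->
  (lebesgueN N).-integrable (eball r) (EFin \o (fun y => g (row_of y))).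
Proof.
move=> cg; have [M _ HM] := bounded_on_cube r cg.
apply: (@integrable_eball _ _ _ _ M).
  by apply: measurable_funTS; exact: measurable_continuous_row.
by move=> y /eball_cube yr; apply: HM => j; rewrite mxE.
Qed.

Lemma integrable_sum_EFin d (T : measurableType d) (m : {measure set T ->
    \bar R})
    (D : set T) n (f : 'I_n -> T -> R) : measurable D ->
  (forall i, m.-integrable D (EFin \o f i)) ->
  m.-integrable D (EFin \o (fun x => \sum_(i < n) f i x)).
Proof.
move=> mD fi; rewrite (_ : _ \o _ = (fun x => \sum_(i < n) (f i x)%:E)%E).
  by apply: integrable_sum => // i _; exact: fi.
by apply/funext => x /=; rewrite sumEFin.
Qed.

Lemma Rintegral_sum d (T : measurableType d) (m : {measure set T -> \bar R})
    (D : set T) n (f : 'I_n -> T -> R) : measurable D ->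
  (forall i, m.-integrable D (EFin \o f i)) ->
  \int[m]_(x in D) (\sum_(i < n) f i x) = \sum_(i < n) \int[m]_(x in D) f i x.
Proof.
move=> mD; elim: n f => [|n IH] f fi.
  rewrite big_ord0 -[RHS]/(fine 0%E).
  rewrite /Rintegral; under eq_integral do rewrite big_ord0.
  by rewrite integral0.
under eq_Rintegral do rewrite big_ord_recl.
rewrite RintegralD// ?IH ?big_ord_recl//.
exact: integrable_sum_EFin.
Qed.

Lemma ball_integral_partial0 N (phi : 'rV[R]_N -> R) j : C1 phi ->
  (forall v, 1 <= sqn v -> phi v = 0) ->
  (forall v, 1 <= sqn v -> partial j phi v = 0) ->
  ball_integral 1 (fun y => partial j phi (row_of y)) = 0.
Proof.
move=> Cphi phi0 dphi0; rewrite /ball_integral /Rintegral.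
rewrite -[RHS]/(fine 0%E); congr fine.
rewrite -(integral_partial0 j Cphi phi0) integral_mkcond.
apply: eq_integral => y _; rewrite patchE; case: ifPn => //.
rewrite notin_setE /eball/= => /negP; rewrite -leNgt => y1.
rewrite dphi0// sqn_row -[X in X <= _](expr1n _ 2).
by rewrite ler_sqr ?nnegrE ?enorm_ge0.
Qed.

Lemma derive_sqn N (v w : 'rV[R]_N) :
  'D_w (@sqn R N) v = \sum_(i < N) 2 * v 0 i * w 0 i.
Proof.
rewrite (_ : @sqn R N = \sum_(i < N) (fun v : 'rV[R]_N => v 0 i * v 0 i)).
  have dc i : derivable (fun v : 'rV[R]_N => v 0 i) v w.
    exact/diff_derivable/differentiable_coord.
  rewrite derive_sum; last by move=> i; exact: derivableM.
  apply: eq_bigr => i _; rewrite deriveM// derive_coord.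
  by rewrite -[_ *: _]/(_ * _) mulr2n !mulrDl !mul1r.
by apply/funext => x; rewrite fct_sumE; apply: eq_bigr => i _; rewrite expr2.
Qed.

(** Mean value theorem along the ray from v to the point v / |v| of the sphere,
    at distance 1 - |v| <= 1 - |v|^2; at the origin any bound on q will do. *)
Lemma vanishing_on_sphere N (q : 'rV[R]_N -> R) : C1 q ->
  (forall v, sqn v = 1 -> q v = 0) ->
  exists2 C, 0 <= C & forall v, sqn v <= 1 -> `|q v| <= C * (1 - sqn v).
Proof.
move=> Cq q0; have cq := C1_continuous Cq; move: Cq => [dq pq].
have [M0 M00 HM0] := bounded_on_cube 1 cq.
have /choice[M HM] : forall j, exists M, 0 <= M /\ forall v : 'rV[R]_N,
    (forall i, `|v 0 i| <= 1) -> `|partial j q v| <= M.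
  by move=> j; have [M ? ?] := bounded_on_cube 1 (pq j); exists M.
have SM : 0 <= \sum_j M j by apply: sumr_ge0 => j _; have [] := HM j.
exists (M0 + \sum_j M j); first exact: addr_ge0.
move=> v v1.
have [v0|v0] := eqVneq (sqn v) 0.
  rewrite v0 subr0 mulr1 (le_trans (HM0 v _)) ?lerDl// => j.
  have := coord_sqn v j; rewrite v0 -real_normK ?num_real// => H.
  by have := normr_ge0 (v 0 j); nra.
have vp : 0 < sqn v by rewrite lt_def v0 sqn_ge0.
pose n := Num.sqrt (sqn v).
have n0 : 0 < n by rewrite sqrtr_gt0.
have nn : n ^+ 2 = sqn v by rewrite sqr_sqrtr ?sqn_ge0.
have n1 : n <= 1 by rewrite -sqrtr1 ler_wsqrtr.
pose w := (n^-1 - 1) *: v.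
have vj j : `|v 0 j| <= n.
  by rewrite -sqrtr_sqr ler_wsqrtr// coord_sqn.
have i1 : 1 <= n^-1 by rewrite invf_ge1.
have Hd (s : R) : 0 <= s <= 1 ->
    is_derive (v + s *: w) w q ('D_w q (v + s *: w)).
  by move=> _; exact/derivableP/diff_derivable.
have [s /andP[s0 s1] E] := @MVT_line _ _ q (fun s =>
    'D_w q (v + s *: w)) v w Hd.
have Evw : v + w = n^-1 *: v by rewrite /w scalerBl scale1r addrC subrK.
have qvw : q (v + w) = 0.
  apply: q0; rewrite Evw /sqn.
  under eq_bigr do rewrite mxE exprMn.
  by rewrite -mulr_sumr -/(sqn v) -nn -exprMn mulVf ?gt_eqF// expr1n.
rewrite qvw sub0r in E.
rewrite -normrN E derive_partial//.
have wj j : `|w 0 j| <= 1 - n.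
  rewrite mxE normrM ger0_norm ?subr_ge0//.
  apply: le_trans (ler_wpM2l _ (vj j)) _; first by rewrite subr_ge0.
  by rewrite mulrBl mulVf ?gt_eqF// mul1r.
have cub j : `|(v + s *: w) 0 j| <= 1.
  rewrite !mxE -{1}(mul1r (v 0 j)) mulrA -mulrDl normrM.
  have Hs : 0 <= 1 + s * (n^-1 - 1) <= n^-1.
    by apply/andP; split; nra.
  rewrite ger0_norm; last by have /andP[] := Hs.
  apply: (@le_trans _ _ (n^-1 * n)); last by rewrite mulVf// gt_eqF.
  by apply: ler_pM => //; have /andP[] := Hs.
apply: le_trans (ler_norm_sum _ _ _) _.
apply: (@le_trans _ _ (\sum_j M j * (1 - n))).
  apply: ler_sum => j _; rewrite normrM mulrC ler_pM//.
  by have [_] := HM j; apply.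
rewrite -mulr_suml; apply: ler_pM => //; first by rewrite subr_ge0.
  by rewrite lerDr.
by rewrite -nn; nra.
Qed.
End BallIntegrals.

Section TangentFields.
Context {R : realType}.

Lemma C1_cutoff N (c : R) :
  C1 (fun v : 'rV[R]_N => cutoff (c * (1 - sqn v))).
Proof.
apply: (@C1_comp1 _ _ _ (@dcutoff R)).
- by apply: C1M; [exact: C1_cst|apply: C1B; [exact: C1_cst|exact: C1_sqn]].
- by move=> x; exact: is_derive_cutoff.
- by move=> x; exact: continuous_dcutoff.
Qed.

Lemma partial_cutoff N (c : R) j (v : 'rV[R]_N) :
  partial j (fun v : 'rV[R]_N => cutoff (c * (1 - sqn v))) v =
  - (2 * c * dcutoff (c * (1 - sqn v)) * v 0 j).
Proof.
have [dsq _] := @C1_sqn R N.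
have da : differentiable (fun v : 'rV[R]_N => c * (1 - sqn v)) v.
  apply: differentiableM; first exact: differentiable_cst.
  by apply: differentiableB => //; exact: differentiable_cst.
rewrite /partial (derive_comp1 _ (is_derive_cutoff _))// deriveM; last 2 first.
- by [].
- by apply/diff_derivable/differentiableB => //; exact: differentiable_cst.
rewrite deriveB//; last exact/diff_derivable.
rewrite !derive_cst derive_sqn scaler0 addr0 sub0r.
rewrite (bigD1 j)//= big1 ?addr0; last first.
  by move=> i ij; rewrite mxE eqxx/= (negPf ij) mulr0.
rewrite mxE !eqxx mulr1 -[_ *: _]/(_ * _); ring.
Qed.

(** With chi_k = cutoff (k (1 - |v|^2)), the divergence of chi_k Z has integral
    0 and equals chi_k div Z - 2 k cutoff'(k (1 - |v|^2)) v . Z.  The second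
    term is bounded and tends to 0, because |v . Z| <= C (1 - |v|^2); the first
    one tends to div Z. *)
Lemma integral_div_tangential N (Z : 'I_N -> 'rV[R]_N -> R) :
  (forall j, C1 (Z j)) ->
  (forall v, sqn v = 1 -> \sum_(j < N) v 0 j * Z j v = 0) ->
  ball_integral 1 (fun y => \sum_(j < N) partial j (Z j) (row_of y)) = 0.
Proof.
move=> CZ Zt.
have cdZ : continuous (fun v => \sum_(j < N) partial j (Z j) v).
  by move=> v; apply: continuous_sum => j; have [_] := CZ j; apply.
pose q (v : 'rV[R]_N) := \sum_(j < N) v 0 j * Z j v.
have Cq : C1 q by apply: C1_sum => j; apply: C1M => //; exact: C1_coord.
have [C C0 HC] := vanishing_on_sphere Cq Zt.
have [M M0 HM] := bounded_on_cube 1 cdZ.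
pose chi k (v : 'rV[R]_N) : R := cutoff (k.+1%:R * (1 - sqn v)).
pose D k (v : 'rV[R]_N) : R := dcutoff (k.+1%:R * (1 - sqn v)).
have Cchi k : C1 (chi k) by exact: C1_cutoff.
pose f k (v : 'rV[R]_N) := \sum_(j < N) partial j (fun v => chi k v * Z j v) v.
have partE k j v : partial j (fun v => chi k v * Z j v) v =
    chi k v * partial j (Z j) v - 2 * k.+1%:R * D k v * (v 0 j * Z j v).
  rewrite partialM; [|by have [] := Cchi k|by have [] := CZ j].
  by rewrite /chi partial_cutoff -/(D k v); ring.
have fE k v : f k v = chi k v * \sum_(j < N) partial j (Z j) v
                      - 2 * k.+1%:R * D k v * q v.
  by rewrite /f mulr_sumr [_ * q v]mulr_sumr -sumrB; apply: eq_bigr => j _.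
have CchiZ k j : C1 (fun v => chi k v * Z j v) by apply: C1M.
have cf k : continuous (f k).
  by move=> v; apply: continuous_sum => j; have [_] := CchiZ k j; apply.
have f0 k : ball_integral 1 (fun y => f k (row_of y)) = 0.
  rewrite /ball_integral Rintegral_sum.
  - apply: big1 => j _; apply: ball_integral_partial0 => // v v1.
      by rewrite /chi cutoff_le0 ?mul0r// mulr_ge0_le0// subr_le0.
    have s0 : k.+1%:R * (1 - sqn v) <= 0 by rewrite mulr_ge0_le0// subr_le0.
    by rewrite partE /chi /D cutoff_le0// dcutoff_le0// mulr0 !mul0r subr0.
  - exact: measurable_eball.
  - by move=> j; apply: integrable_continuous_row; have [_] := CchiZ k j; apply.
have sq1 (y : N.-tuple R) : eball 1 y -> sqn (row_of y) < 1.
  move=> y1; rewrite sqn_row -[X in _ < X](expr1n _ 2).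
  by rewrite ltr_sqr ?nnegrE ?enorm_ge0.
have Mrow (y : N.-tuple R) : eball 1 y ->
    `|\sum_(j < N) partial j (Z j) (row_of y)| <= M.
  by move=> /eball_cube y1; apply: HM => j; rewrite mxE.
have dom k (y : N.-tuple R) : eball 1 y ->
    `|2 * k.+1%:R * D k (row_of y) * q (row_of y)|
    <= 2 * C * (2 * (1 + (k.+1%:R * (1 - sqn (row_of y))) ^+ 2)^-1).
  move=> y1; set v := row_of y; have v1 := sq1 _ y1; rewrite -/v in v1.
  have s0 : 0 <= k.+1%:R * (1 - sqn v) by rewrite mulr_ge0// subr_ge0 ltW.
  have /andP[b0 b1] := dcutoff_bound s0.
  have d0 : 0 <= D k v.
    apply: divr_ge0; first by rewrite mulr_ge0// le_max lexx orbT.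
    by rewrite exprn_ge0// addr_ge0// sqr_ge0.
  rewrite normrM ger0_norm; last by apply: mulr_ge0.
  have d1 : 0 <= 2 * k.+1%:R * D k v by apply: mulr_ge0.
  apply: le_trans (ler_wpM2l d1 (HC v (ltW v1))) _.
  rewrite (_ : _ * (C * _) = 2 * C * (k.+1%:R * (1 - sqn v) * D k v));
      last by ring.
  by rewrite ler_wpM2l// mulr_ge0.
have mB := @measurable_eball R N 1.
have L : (\int[lebesgueN N]_(y in eball 1)
    (f k (row_of y))%:E)%E @[k --> \oo] -->
    (\int[lebesgueN N]_(y in eball 1) (\sum_(j < N) partial j (Z j)
        (row_of y))%:E)%E.
  apply: (@dominated_cvg _ _ _ _ _ mB _ _ (fun y => (M + 2 * C * 2)%:E)).
  - move=> k; apply/measurable_EFinP; apply: measurable_funTS.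
    exact: (measurable_continuous_row (cf k)).
  - move=> y y1; apply: cvg_EFin; first exact: nearW.
    under eq_fun do rewrite fE.
    have s0 : 0 < 1 - sqn (row_of y) by rewrite subr_gt0 sq1.
    suff : chi k (row_of y) * (\sum_(j < N) partial j (Z j) (row_of y)) -
       2 * k.+1%:R * D k (row_of y) * q (row_of y) @[k --> \oo] -->
       1 * (\sum_(j < N) partial j (Z j) (row_of y)) - 0.
      by rewrite mul1r subr0.
    apply: cvgB; first by apply: cvgMl; exact: cvg_cutoff.
    apply/norm_cvg0P.
    apply: (@squeeze_cvgr _ _ _ _ (cst 0) (fun k =>
        2 * C * (2 * (1 + (k.+1%:R * (1 - sqn (row_of y))) ^+ 2)^-1))).
    + by near=> k; rewrite normr_ge0 dom.
    + exact: cvg_cst.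
    + rewrite (_ : 0 = 2 * C * (2 * 0)); last by rewrite !mulr0.
      by apply: cvgMr; apply: cvgMr; exact: cvg_inv_sqr.
  - by [].
  - by apply: (@integrable_continuous_row R N 1 (fun=> M + 2 * C * 2)) => v;
      exact: cst_continuous.
  - move=> k y y1; rewrite /= lee_fin fE (le_trans (ler_normB _ _))// lerD//.
      rewrite normrM; have /andP[c0 c1] :=
          cutoff_itv (k.+1%:R * (1 - sqn (row_of y))).
      by rewrite ger0_norm// (le_trans _ (Mrow _ y1))// ler_piMl.
    apply: le_trans (dom k y y1) _; rewrite ler_wpM2l ?mulr_ge0//.
    by rewrite ger_pMr// invf_le1 ?lerDl ?sqr_ge0// ltr_pwDl// sqr_ge0.
rewrite /ball_integral /Rintegral; set I := integral _ _ _ in L *.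
suff -> : I = 0%E by [].
have If k : (\int[lebesgueN N]_(y in eball 1) (f k (row_of y))%:E = 0)%E.
  rewrite -[LHS]fineK ?[fine _]f0//.
  exact: (integrable_fin_num mB (integrable_continuous_row 1 (cf k))).
move: L; under eq_fun do rewrite If.
by move=> /cvg_lim <-//; rewrite lim_cst.
Unshelve. all: by end_near. Qed.
End TangentFields.

(** * The divergence theorem on balls *)

Section SmoothDirection.
Context {R : realType}.

Lemma is_derive_invsqrt (s : R) : 0 < s ->
  is_derive s 1 (fun s => (Num.sqrt s)^-1) (- (2 * Num.sqrt s ^+ 3)^-1).
Proof.
move=> s0; have r0 : Num.sqrt s != 0 by rewrite gt_eqF// sqrtr_gt0.
have H := @is_deriveV _ _ _ _ _ r0 (is_derive1_sqrt s0).
apply: is_derive_eq H _; by rewrite -[_ *: _]/(_ * _); field.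
Qed.

Lemma continuous_invsqrt (s : R) : 0 < s ->
  {for s, continuous (fun s => (Num.sqrt s)^-1)}.
Proof.
move=> s0; apply: continuousV; first by rewrite gt_eqF// sqrtr_gt0.
exact: sqrt_continuous.
Qed.

(** A regularization of |v|^2: equal to d at 0, it still is 1 on the unit
    sphere. *)
Definition smooth_sqn N (d : R) (v : 'rV[R]_N) := (1 - d) * sqn v + d.
Definition smooth_dir N (d : R) (v : 'rV[R]_N) : 'rV[R]_N :=
  \row_i ((Num.sqrt (smooth_sqn d v))^-1 * v 0 i).

Section FixedParameter.
Variables (N : nat) (d : R).
Hypotheses (d0 : 0 < d) (d1 : d < 1).
Local Notation a := (@smooth_sqn N d).

Lemma smooth_sqn_gt0 v : 0 < a v.
Proof. by rewrite ltr_wpDl// mulr_ge0 ?sqn_ge0// subr_ge0 ltW. Qed.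

Lemma C1_smooth_sqn : C1 a.
Proof.
by apply: C1D; [apply: C1M; [exact: C1_cst|exact: C1_sqn]|exact: C1_cst].
Qed.

Lemma C1_invsqrt_smooth_sqn : C1 (fun v => (Num.sqrt (a v))^-1).
Proof.
apply: (@C1_comp1 _ _ (fun s => (Num.sqrt s)^-1) (fun s =>
    - (2 * Num.sqrt s ^+ 3)^-1)).
- exact: C1_smooth_sqn.
- by move=> v; apply: is_derive_invsqrt; exact: smooth_sqn_gt0.
move=> v; apply: (@continuousN _ _ _ (fun s : R => (2 * Num.sqrt s ^+ 3)^-1)).
have r0 : Num.sqrt (a v) != 0 by rewrite gt_eqF// sqrtr_gt0 smooth_sqn_gt0.
apply: (@continuousV _ _ (fun s : R => 2 * Num.sqrt s ^+ 3)).
  by rewrite mulf_neq0// expf_neq0.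
apply: (@continuousM _ _ (cst 2) (fun s : R => Num.sqrt s ^+ 3));
    first exact: cst_continuous.
apply: (@continuous_comp _ _ _ (@Num.sqrt R) (fun x => x ^+ 3));
    last exact: exprn_continuous.
exact: sqrt_continuous.
Qed.

Lemma C1_smooth_dir i : C1 (fun v => (Num.sqrt (a v))^-1 * v 0 i).
Proof. by apply: C1M; [exact: C1_invsqrt_smooth_sqn|exact: C1_coord]. Qed.

(** Euler's relation for the almost 0-homogeneous function K o smooth_dir: the
    radial derivative of v / sqrt(a) is (v / sqrt(a)) d / a, where a is the
    regularized |v|^2. *)
Lemma euler_smooth_dir (K : 'rV[R]_N -> R) (v : 'rV[R]_N) : C1 K ->
  \sum_j v 0 j * partial j (fun v => K (smooth_dir d v)) v =
  d / a v * \sum_j smooth_dir d v 0 j * partial j K (smooth_dir d v).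
Proof.
move=> CK; have CKd : C1 (fun v => K (smooth_dir d v)).
  by apply: C1_comp_row => // i; exact: C1_smooth_dir.
rewrite -derive_partial; last by have [] := CKd.
rewrite derive_comp_row; last 2 first.
- by move=> i; have [] := C1_smooth_dir i.
- by have [] := CK.
rewrite mulr_sumr; apply: eq_bigr => i _; rewrite mulrA; congr (_ * _).
have a0 := smooth_sqn_gt0 v.
have [da _] := C1_smooth_sqn.
have [dia _] := C1_invsqrt_smooth_sqn.
rewrite deriveM; [|exact:
    diff_derivable|exact/diff_derivable/differentiable_coord].
rewrite derive_coord (derive_comp1 _ (is_derive_invsqrt a0))//.
have -> : 'D_v a v = (1 - d) * (2 * sqn v).
  rewrite deriveD; last 2 first.
  - apply: derivableM; [exact: derivable_cst|].
    by have [dq _] := @C1_sqn R N; exact/diff_derivable.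
  - exact: derivable_cst.
  rewrite derive_cst addr0 deriveM; last 2 first.
  - exact: derivable_cst.
  - by have [dq _] := @C1_sqn R N; exact/diff_derivable.
  rewrite derive_cst scaler0 addr0 derive_sqn -[_ *: _]/(_ * _); congr (_ * _).
  by rewrite /sqn mulr_sumr; apply: eq_bigr => k _; rewrite expr2 mulrA.
rewrite mxE -![_ *: _]/(_ * _).
have r0 : Num.sqrt (a v) != 0 by rewrite gt_eqF// sqrtr_gt0.
have ar : a v = Num.sqrt (a v) ^+ 2 by rewrite sqr_sqrtr// ltW.
have sq : (1 - d) * sqn v = Num.sqrt (a v) ^+ 2 - d by rewrite -ar /smooth_sqn
    addrK.
have -> : d / a v = d / Num.sqrt (a v) ^+ 2 by rewrite -ar.
have -> : (1 - d) * (2 * sqn v) = 2 * (Num.sqrt (a v) ^+ 2 - d).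
  by rewrite -sq mulrCA.
by field.
Qed.

Lemma smooth_dir_le1 (v : 'rV[R]_N) j : sqn v <= 1 ->
    `|smooth_dir d v 0 j| <= 1.
Proof.
move=> v1; have a0 := smooth_sqn_gt0 v;
    rewrite mxE normrM ger0_norm ?invr_ge0 ?sqrtr_ge0//.
rewrite ler_pdivrMl ?sqrtr_gt0// mulr1 -sqrtr_sqr ler_wsqrtr//.
apply: le_trans (coord_sqn v j) _; rewrite -subr_ge0.
rewrite (_ : _ - _ = d * (1 - sqn v)); last by rewrite /smooth_sqn; ring.
by rewrite mulr_ge0 ?(ltW d0)// subr_ge0.
Qed.

Lemma smooth_ratio_le1 (v : 'rV[R]_N) : 0 <= d / a v <= 1.
Proof.
have a0 := smooth_sqn_gt0 v.
rewrite divr_ge0 ?(ltW d0) ?(ltW a0)//= ler_pdivrMr// mul1r /smooth_sqn lerDr.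
by rewrite mulr_ge0 ?sqn_ge0// subr_ge0 ltW.
Qed.
End FixedParameter.
End SmoothDirection.

Section UnitBall.
Context {R : realType}.

(** The field G v - (K (smooth_dir v)) v is tangent to the unit sphere, since
    smooth_dir v = v there. *)
Lemma divergence_unit_ball_smooth N (G : 'I_N -> 'rV[R]_N ->
    R) (d : R) : 0 < d -> d < 1 ->
  (forall j, C1 (G j)) ->
  let K := fun v : 'rV[R]_N => \sum_(j < N) v 0 j * G j v in
  let E := fun v : 'rV[R]_N => \sum_(j < N) v 0 j * partial j K v in
  ball_integral 1 (fun y => \sum_(j < N) partial j (G j) (row_of y)) =
  ball_integral 1 (fun y => N%:R * K (smooth_dir d (row_of y))
     + d / smooth_sqn d (row_of y) * E (smooth_dir d (row_of y))).
Proof.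
move=> d0 d1 CG K E.
have CK : C1 K by apply: C1_sum => j; apply: C1M => //; exact: C1_coord.
pose w v := K (smooth_dir d v).
have Cw : C1 w by apply: C1_comp_row => // i; exact: C1_smooth_dir.
pose W j (v : 'rV[R]_N) := v 0 j * w v.
have CW j : C1 (W j) by apply: C1M => //; exact: C1_coord.
pose Z j v := G j v - W j v.
have CZ j : C1 (Z j) by exact: C1B.
have Zt v : sqn v = 1 -> \sum_(j < N) v 0 j * Z j v = 0.
  move=> v1; under eq_bigr do rewrite mulrBr.
  rewrite sumrB -/(K v).
  under eq_bigr do rewrite mulrA -expr2.
  rewrite -mulr_suml -/(sqn v) v1 mul1r /w (_ : smooth_dir d v = v) ?subrr//.
  by apply/rowP => i; rewrite mxE /smooth_sqn v1 mulr1 subrK sqrtr1 invr1 mul1r.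
have WE v : \sum_(j < N) partial j (W j) v = N%:R * K (smooth_dir d v)
     + d / smooth_sqn d v * E (smooth_dir d v).
  rewrite -(euler_smooth_dir d0 d1 _ CK) -/w.
  have -> : N%:R * K (smooth_dir d v) = \sum_(j < N) w v.
    by rewrite sumr_const card_ord mulr_natl.
  rewrite -big_split/=; apply: eq_bigr => j _; rewrite partialM; last 2 first.
  - exact: differentiable_coord.
  - by have [] := Cw.
  have -> : partial j (fun y : 'rV[R]_N => y 0 j) v = 1.
    by rewrite /partial derive_coord mxE !eqxx.
  by rewrite mulr1 addrC.
have mB := @measurable_eball R N 1.
have iG : (lebesgueN N).-integrable (eball 1)
    (EFin \o (fun y => \sum_(j < N) partial j (G j) (row_of y))).
  apply: (@integrable_continuous_row R N 1 (fun v =>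
      \sum_(j < N) partial j (G j) v)).
  by move=> v; apply: continuous_sum => j; have [_] := CG j; apply.
have iW : (lebesgueN N).-integrable (eball 1)
    (EFin \o (fun y => \sum_(j < N) partial j (W j) (row_of y))).
  apply: (@integrable_continuous_row R N 1 (fun v =>
      \sum_(j < N) partial j (W j) v)).
  by move=> v; apply: continuous_sum => j; have [_] := CW j; apply.
have := integral_div_tangential CZ Zt.
rewrite /ball_integral; under eq_Rintegral => y _.
  under eq_bigr => j _.
    rewrite /partial deriveB; last 2 first.
    - by have [dG _] := CG j; exact/diff_derivable.
    - by have [dW _] := CW j; exact/diff_derivable.
    over.
  rewrite sumrB; over.
rewrite RintegralB// => /eqP; rewrite subr_eq0 => /eqP ->.
by apply: eq_Rintegral => y _; rewrite -WE.
Qed.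

Lemma continuous_ray N (f : 'rV[R]_N -> R) (v : 'rV[R]_N) : continuous f ->
  continuous (fun c : R => f (\row_i (c * v 0 i))).
Proof.
move=> cf c; apply: (@continuous_comp _ _ _ (fun c : R =>
    \row_i (c * v 0 i) : 'rV[R]_N) f); last exact: cf.
apply: continuous_row => i.
by apply: (@continuousM _ _ id (cst (v 0 i)));
    [exact: cvg_id|exact: cst_continuous].
Qed.

(** Limit d -> 0 in divergence_unit_ball_smooth, by dominated convergence.
    Pointwise convergence also holds at the origin, where smooth_dir and
    y |-> y / |y| agree, the inverse of 0 being 0. *)
Lemma divergence_unit_ball N (G : 'I_N -> 'rV[R]_N -> R) :
  (forall j, C1 (G j)) ->
  let K := fun v : 'rV[R]_N => \sum_(j < N) v 0 j * G j v in
  ball_integral 1 (fun y => \sum_(j < N) partial j (G j) (row_of y)) =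
  N%:R * ball_integral 1 (fun y => K (row_of (scale (enorm y)^-1 y))).
Proof.
move=> CG K; pose E := fun v : 'rV[R]_N => \sum_(j < N) v 0 j * partial j K v.
have CK : C1 K by apply: C1_sum => j; apply: C1M => //; exact: C1_coord.
have cK := C1_continuous CK.
have cE : continuous E.
  move=> v; apply: continuous_sum => j; apply: continuousM;
      first exact: coord_continuous.
  by have [_] := CK; apply.
(* In ]0, 1[ for every k, 0 included. *)
pose d (k : nat) : R := k.+2%:R^-1.
have d0 k : 0 < d k by rewrite invr_gt0.
have d1 k : d k < 1 by rewrite invf_lt1// ltr1n.
pose h k y := N%:R * K (smooth_dir (d k) (row_of y))
     + d k / smooth_sqn (d k) (row_of y) * E (smooth_dir (d k) (row_of y)).
have [MK MK0 HMK] := bounded_on_cube 1 cK.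
have [ME ME0 HME] := bounded_on_cube 1 cE.
have mB := @measurable_eball R N 1.
have ch k : measurable_fun [set: N.-tuple R] (h k).
  apply: (@measurable_continuous_row R N (fun v => N%:R * K (smooth_dir (d k) v)
     + d k / smooth_sqn (d k) v * E (smooth_dir (d k) v))) => v.
  have cs : {for v, continuous (smooth_dir (d k) : 'rV[R]_N -> 'rV[R]_N)}.
    by apply: continuous_row => i; apply: C1_continuous; exact: C1_smooth_dir.
  have c1 : {for v, continuous (fun v => N%:R * K (smooth_dir (d k) v))}.
    apply: (@continuousM _ _ (cst N%:R) (fun v => K (smooth_dir (d k) v))).
      exact: cst_continuous.
    by apply: (@continuous_comp _ _ _ (smooth_dir (d k)) K) => //; exact: cK.
  have c2 : {for v, continuous (fun v => d k / smooth_sqn (d k) v)}.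
    apply: (@continuousM _ _ (cst (d k)) (fun v => (smooth_sqn (d k) v)^-1)).
      exact: cst_continuous.
    apply: continuousV; first by rewrite gt_eqF// smooth_sqn_gt0.
    by apply: C1_continuous; exact: C1_smooth_sqn.
  have c3 : {for v, continuous (fun v => E (smooth_dir (d k) v))}.
    by apply: (@continuous_comp _ _ _ (smooth_dir (d k)) E) => //; exact: cE.
  exact: (continuousD c1 (continuousM c2 c3)).
have mscale : measurable_fun [set: N.-tuple R] (fun y : N.-tuple R =>
    scale (enorm y)^-1 y).
  apply: measurable_scale => //.
  rewrite (_ : (fun y : N.-tuple R => _) = (fun x => x `^ (-1)) \o @enorm R N).
    apply: measurableT_comp; first exact: measurable_powR.
    exact: measurable_enorm.
  by apply/funext => y /=; rewrite powR_inv1// enorm_ge0.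
have mK' : measurable_fun [set: N.-tuple R] (fun y =>
    K (row_of (scale (enorm y)^-1 y))).
  exact: (measurableT_comp (measurable_continuous_row cK) mscale).
have sq1 (y : N.-tuple R) : eball 1 y -> sqn (row_of y) <= 1.
  move=> y1; rewrite sqn_row -[X in _ <= X](expr1n _ 2).
  by rewrite ler_sqr ?nnegrE ?enorm_ge0// ltW.
have hbound k y : eball 1 y -> `|h k y| <= N%:R * MK + ME.
  move=> y1; rewrite (le_trans (ler_normD _ _))// lerD// normrM.
    rewrite ger0_norm// ler_wpM2l// HMK// => j.
    by apply: smooth_dir_le1 => //; exact: sq1.
  have /andP[r0 r1] := smooth_ratio_le1 (d0 k) (d1 k) (row_of y).
  rewrite ger0_norm// -[leRHS]mul1r ler_pM// HME// => j.
  by apply: smooth_dir_le1 => //; exact: sq1.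
have cd : d k @[k --> \oo] --> 0.
  by have := @cvg_harmonic R; rewrite -cvg_shiftS.
have L : (\int[lebesgueN N]_(y in eball 1) (h k y)%:E)%E @[k --> \oo] -->
    (\int[lebesgueN N]_(y in eball 1)
        (N%:R * K (row_of (scale (enorm y)^-1 y)))%:E)%E.
  apply: (@dominated_cvg _ _ _ _ _ mB _ _ (fun y => (N%:R * MK + ME)%:E)).
  - by move=> k; apply/measurable_EFinP; apply: measurable_funTS.
  - move=> y y1; apply: cvg_EFin; first exact: nearW.
    suff : h k y @[k --> \oo] --> N%:R * K (row_of (scale (enorm y)^-1 y))
      by [].
    set v := row_of y.
    pose F c := K (\row_i (c * v 0 i)); pose EF c := E (\row_i (c * v 0 i)).
    have cF : continuous F by exact: continuous_ray.
    have cEF : continuous EF by exact: continuous_ray.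
    have -> : row_of (scale (enorm y)^-1 y) = \row_i ((enorm y)^-1 * v 0 i).
      by apply/rowP => i; rewrite !mxE scaleE.
    have [v0|v0] := eqVneq v 0.
      have r0 (c : R) : \row_i (c * v 0 i) = 0 :> 'rV[R]_N.
        by apply/rowP => i; rewrite v0 !mxE mulr0.
      rewrite (_ : h ^~ y = cst (N%:R * K (\row_i ((enorm y)^-1 * v 0 i)))).
        exact: cvg_cst.
      apply/funext => k; rewrite /h -/v /smooth_dir !r0.
      rewrite [E 0](_ : _ = 0) ?mulr0 ?addr0//.
      by rewrite /E big1// => j _; rewrite mxE mul0r.
    have s0 : 0 < sqn v.
      rewrite lt_def sqn_ge0 andbT; apply: contra_neq v0 => v0.
      apply/rowP => i; rewrite [RHS]mxE; apply/eqP; rewrite -sqrf_eq0.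
      by rewrite eq_le sqr_ge0 andbT -v0 coord_sqn.
    have ca : smooth_sqn (d k) v @[k --> \oo] --> sqn v.
      rewrite (_ : sqn v = (1 - 0) * sqn v + 0);
          last by rewrite subr0 mul1r addr0.
      apply: cvgD => //; apply: cvgMl; apply: cvgB => //; exact: cvg_cst.
    have cpsi : (Num.sqrt (smooth_sqn (d k) v))^-1 @[k --> \oo] -->
        (enorm y)^-1.
      rewrite enorm_row -/v.
      exact: (continuous_cvg _ (continuous_invsqrt s0) ca).
    suff : N%:R * F ((Num.sqrt (smooth_sqn (d k) v))^-1) +
       d k / smooth_sqn (d k) v * EF ((Num.sqrt (smooth_sqn (d k) v))^-1)
       @[k --> \oo] --> N%:R * F ((enorm y)^-1) + 0 / sqn v * EF ((enorm y)^-1).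
      by rewrite mul0r mul0r addr0.
    apply: cvgD; apply: cvgM.
    - exact: cvg_cst.
    - exact: (continuous_cvg _ (cF _) cpsi).
    - by apply: cvgM => //; apply: cvgV => //; rewrite gt_eqF.
    - exact: (continuous_cvg _ (cEF _) cpsi).
  - by [].
  - by apply: (@integrable_continuous_row R N 1 (fun=> N%:R * MK + ME)) => v;
      exact: cst_continuous.
  - by move=> k y y1; rewrite /= lee_fin hbound.
have iG : (lebesgueN N).-integrable (eball 1)
    (EFin \o (fun y => \sum_(j < N) partial j (G j) (row_of y))).
  apply: (@integrable_continuous_row R N 1 (fun v =>
      \sum_(j < N) partial j (G j) v)).
  by move=> v; apply: continuous_sum => j; have [_] := CG j; apply.
have iK : (lebesgueN N).-integrable (eball 1)
    (EFin \o (fun y => K (row_of (scale (enorm y)^-1 y)))).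
  apply: (@integrable_eball _ _ _ _ MK); first exact: measurable_funTS mK'.
  move=> y y1; apply: HMK => j;
      rewrite mxE scaleE normrM ger0_norm ?invr_ge0 ?enorm_ge0//.
  have [->|y0] := eqVneq (enorm y) 0; first by rewrite invr0 mul0r.
  by rewrite ler_pdivrMl ?mulr1 ?tnth_le_enorm// lt_def y0 enorm_ge0.
rewrite /ball_integral -RintegralZl//.
rewrite /Rintegral; congr fine; apply/esym.
suff If k : (\int[lebesgueN N]_(y in eball 1) (h k y)%:E =
    \int[lebesgueN N]_(y in eball 1) (\sum_(j < N) partial j (G j)
        (row_of y))%:E)%E.
  move: L; under eq_fun do rewrite If.
  by move=> /cvg_lim <-//; rewrite lim_cst.
have := divergence_unit_ball_smooth (d0 k) (d1 k) CG.
rewrite /ball_integral /Rintegral -/(K) -/(E) => H.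
rewrite -[LHS]fineK; last first.
  apply: (integrable_fin_num mB);
      apply: (@integrable_eball _ _ _ _ (N%:R * MK + ME)).
    exact: measurable_funTS.
  exact: hbound.
by rewrite -[RHS]fineK ?H// (integrable_fin_num mB).
Unshelve. all: by end_near. Qed.
End UnitBall.

Section DivergenceBall.
Context {R : realType}.

Lemma partial_dilation N (f : 'rV[R]_N -> R) (r : R) j v : C1 f ->
  partial j (fun v : 'rV[R]_N => f (\row_i (r * v 0 i))) v =
  r * partial j f (\row_i (r * v 0 i)).
Proof.
move=> [df _]; have dc i : differentiable (fun v : 'rV[R]_N => r * v 0 i) v.
  apply: differentiableM; first exact: differentiable_cst.
  exact: differentiable_coord.
have Dc i : 'D_(delta_mx 0 j) (fun v : 'rV[R]_N =>
    r * v 0 i) v = r * (i == j)%:R.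
  rewrite deriveM; [|exact: derivable_cst|
      exact/diff_derivable/differentiable_coord].
  by rewrite derive_cst scaler0 addr0 derive_coord mxE eqxx.
rewrite /partial derive_comp_row// (bigD1 j)//= Dc eqxx mulr1 big1 ?addr0//.
by move=> i ij; rewrite Dc (negPf ij) mulr0 mul0r.
Qed.

(** Reduction to the unit ball by y |-> r y.  The projection y / |y| sends 0
    to 0, where both integrands vanish. *)
Lemma divergence_ball N (G : 'I_N -> 'rV[R]_N -> R) (r : R) : (0 < N)%N ->
  0 < r -> (forall j, C1 (G j)) ->
  ball_integral r (fun y => \sum_(j < N) partial j (G j) (row_of y)) =
  sphere_integral r (fun y => \sum_(j < N) tnth y j / enorm y * G j (row_of y)).
Proof.
move=> N0 r0 CG.
pose G' j (v : 'rV[R]_N) := G j (\row_i (r * v 0 i)).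
have CG' j : C1 (G' j).
  by apply: C1_comp_row => // i; apply: C1M; [exact: C1_cst|exact: C1_coord].
have cdG : continuous (fun v => \sum_(j < N) partial j (G j) v).
  by move=> v; apply: continuous_sum => j; have [_] := CG j; apply.
have [M M0 HM] := bounded_on_cube r cdG.
rewrite (@ball_integral_dilation _ _ _ _ M)//; last 2 first.
- exact: measurable_continuous_row cdG.
- by move=> y /eball_cube yr; apply: HM => j; rewrite mxE.
have mB := @measurable_eball R N 1.
have rowE (y : N.-tuple R) : row_of (scale r y) = \row_i (r * (row_of y) 0 i).
  by apply/rowP => i; rewrite !mxE scaleE.
have -> : r ^+ N = r ^+ N.-1 * r by rewrite -exprSr prednK.
rewrite -mulrA /ball_integral -RintegralZl//; last first.
  have cs : continuous (fun v : 'rV[R]_N =>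
      \sum_(j < N) partial j (G j) (\row_i (r * v 0 i))).
    move=> v; apply: (@continuous_comp _ _ _ (fun v : 'rV[R]_N =>
        \row_i (r * v 0 i) : 'rV[R]_N) (fun w =>
        \sum_(j < N) partial j (G j) w)); last exact: cdG.
    apply: continuous_row => i;
        apply: (@continuousM _ _ (cst r) (fun v : 'rV[R]_N => v 0 i)).
      exact: cst_continuous.
    exact: coord_continuous.
  have := @integrable_continuous_row R N 1 _ cs.
  by congr (_.-integrable _ _); apply/funext => y /=; rewrite rowE.
transitivity (r ^+ N.-1 * ball_integral 1 (fun y =>
    \sum_(j < N) partial j (G' j) (row_of y))).
  congr (_ * _); apply: eq_Rintegral => y _; rewrite rowE mulr_sumr.
  by apply: eq_bigr => j _; rewrite partial_dilation.
rewrite (divergence_unit_ball CG') /sphere_integral mulrCA -mulrA;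
    congr (_ * (_ * _)).
apply: eq_Rintegral => y _.
have [y0|y0] := eqVneq (enorm y) 0.
  apply: eq_bigr => j _; rewrite !mxE !scaleE.
  by rewrite y0 invr0 !(mul0r, mulr0).
apply: eq_bigr => j _;
    rewrite enorm_scale normrM normfV [`|enorm y|]ger0_norm ?enorm_ge0//.
rewrite divfK// !mxE !scaleE gtr0_norm//; congr (_ * _).
  by field; rewrite y0 gt_eqF.
by congr (G j _); apply/rowP => i; rewrite !mxE !scaleE mulrA.
Qed.
End DivergenceBall.

(** * The conservation law for the energy density *)

Section Ellipticity.
Context {R : realType}.

(** 2 s Phi'(s) - Phi(s) has derivative Phi' + 2 s Phi'' > 0, and near 0 it is
    at least - Phi, which tends to 0. *)
Lemma Phi_bounds (Phi : R -> R) s : admissible_Phi Phi -> 0 <= s ->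
  0 <= Phi s <= 2 * s * derive1 Phi s.
Proof.
move=> [cPhi dPhi Phi0 Phip]; rewrite le_eqVlt => /predU1P[<-|s0].
  by rewrite Phi0 mulr0 mul0r lexx.
have [P1 P2 P3] := Phip _ s0; rewrite (ltW P1)/=.
pose p t := 2 * t * derive1 Phi t - Phi t.
have Hd (t : R) : 0 < t ->
    is_derive t 1 p (derive1 Phi t + 2 * t * derive1n 2 Phi t).
  move=> t0; have [d1 d2 _] := dPhi _ t0.
  have -> : derive1 Phi t + 2 * t * derive1n 2 Phi t =
    (2 * t * derive1n 2 Phi t + derive1 Phi t * 2) - derive1 Phi t by ring.
  apply: is_deriveB; last by rewrite derive1E; exact/derivableP.
  have H1 : is_derive t 1 (fun t : R => 2 * t) 2.
    rewrite -[X in is_derive _ _ _ X]mulr1.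
    rewrite (_ : (fun t => 2 * t) = 2 *: id); last by apply/funext.
    exact: is_deriveZ.
  have H2 : is_derive t 1 (derive1 Phi) (derive1n 2 Phi t).
    by rewrite /derive1n/= derive1E; exact/derivableP.
  exact: is_deriveM H1 H2.
rewrite -subr_ge0 -/(p s); apply/ler_addgt0Pl => e e0.
have [x /andP[x0 xs] Px] : exists2 x, 0 < x < s & Phi x < e.
  have [_ Phi0r] := (continuous_within_itvcyP 0 Phi).1 cPhi.
  have : \forall x \near 0^'+, (0 < x < s) /\ (Phi x < e).
    near=> x; split; last first.
      by near: x; apply: cvgr_lt Phi0r _ _; rewrite Phi0.
    apply/andP; split; near: x; [exact: nbhs_right_gt|exact: nbhs_right_lt].
  by move=> /filter_ex[x []]; exists x.
have [||c] := @MVT_segment _ p (fun t =>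
    derive1 Phi t + 2 * t * derive1n 2 Phi t) x s (ltW xs).
- by move=> t; rewrite in_itv/= => /andP[xt _]; apply: Hd; exact: lt_trans xt.
- apply: derivable_within_continuous => t; rewrite in_itv/= => /andP[xt _].
  by have [] := Hd t (lt_le_trans x0 xt).
rewrite in_itv/= => /andP[xc cs] E.
have c0 := lt_le_trans x0 xc; have [_ _ H] := Phip _ c0.
have : 0 <= p s - p x by rewrite E mulr_ge0 ?(ltW H)// subr_ge0 ltW.
have [_ Q2 _] := Phip _ x0.
have : 0 <= 2 * x * derive1 Phi x by rewrite !mulr_ge0// ltW.
rewrite /p; lra.
Unshelve. all: by end_near. Qed.

Lemma is_derive_squeeze0 (V : normedModType R) (f b : V -> R) x v :
  (forall y, 0 <= f y <= b y) -> b x = 0 -> is_derive x v b 0 ->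
  is_derive x v f 0.
Proof.
move=> fb b0 [db Db].
have f0 : f x = 0.
  have /andP[h1 h2] := fb x; rewrite b0 in h2.
  by apply/eqP; rewrite eq_le h1 h2.
have Lb : h^-1 *: (b (h *: v + x) - b x) @[h --> 0^'] --> 'D_v b x by exact: db.
rewrite Db in Lb.
have L : h^-1 *: (f (h *: v + x) - f x) @[h --> 0^'] --> (0 : R).
  apply/norm_cvg0P; apply: (@squeeze_cvgr _ _ _ _ (cst 0) (fun h =>
      `|h^-1 *: (b (h *: v + x) - b x)|)).
  - near=> h; rewrite normr_ge0/= f0 b0 !subr0 !normrZ ler_wpM2l//.
    by have /andP[h1 h2] := fb (h *: v + x); rewrite !ger0_norm// (le_trans h1).
  - exact: cvg_cst.
  - exact/norm_cvg0P.
split; first by apply/cvg_ex; exists 0.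
exact: cvg_lim L.
Unshelve. all: by end_near. Qed.
End Ellipticity.

Section EnergyDensity.
Context {R : realType}.

Lemma is_derive_cstM (V : normedModType R) (f : V -> R) (c : R) x v l :
  is_derive x v f l -> is_derive x v (fun y => c * f y) (c * l).
Proof. exact: (@is_deriveZ R V R f c x v l). Qed.

Lemma C1_grad_sq N (u : 'rV[R]_N -> R) : C2 u -> C1 (grad_sq u).
Proof.
move=> [_ Cu]; rewrite (_ : grad_sq u = fun x =>
    \sum_(j < N) partial j u x * partial j u x).
  by apply: C1_sum => j; apply: C1M; exact: Cu.
by apply/funext => x; apply: eq_bigr => j _; rewrite expr2.
Qed.

Lemma derive_grad_sq N (u : 'rV[R]_N -> R) x v : C2 u ->
  'D_v (grad_sq u) x = \sum_(j < N) 2 * partial j u x * 'D_v (partial j u) x.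
Proof.
move=> [_ Cu]; have du j : derivable (partial j u) x v.
  by apply: diff_derivable; have [+ _] := Cu j; apply.
rewrite (_ : grad_sq u = \sum_(j < N) (fun x => partial j u x * partial j u x)).
  rewrite derive_sum; last by move=> j; exact: derivableM.
  apply: eq_bigr => j _; rewrite deriveM//.
  by rewrite -[_ *: _]/(_ * _) mulr2n !mulrDl !mul1r.
by apply/funext => y; rewrite fct_sumE; apply: eq_bigr => j _; rewrite expr2.
Qed.

Lemma grad_sq_ge0 N (u : 'rV[R]_N -> R) x : 0 <= grad_sq u x.
Proof. by apply: sumr_ge0 => j _; exact: sqr_ge0. Qed.

Lemma grad_sq_eq0 N (u : 'rV[R]_N -> R) x j : grad_sq u x = 0 ->
    partial j u x = 0.
Proof.
move=> g0; have : partial j u x ^+ 2 <= grad_sq u x.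
  by rewrite /grad_sq (bigD1 j)//= lerDl sumr_ge0// => i _; exact: sqr_ge0.
rewrite g0 => h; apply/eqP; rewrite -sqrf_eq0; apply/eqP.
by apply/eqP; rewrite eq_le h sqr_ge0.
Qed.

(** Chain rule where grad u <> 0.  Where grad u = 0, Phi (grad_sq u) is
    squeezed between 0 and twice the sum of the products (partial j u) (flux j),
    in which both factors vanish. *)
Lemma is_derive_Phi_grad_sq N (Phi : R -> R) (u : 'rV[R]_N -> R) x v :
  admissible_Phi Phi -> C2 u -> (forall j, C1 (flux Phi u j)) ->
  is_derive x v (fun y => Phi (grad_sq u y))
    (\sum_(j < N) 2 * flux Phi u j x * 'D_v (partial j u) x).
Proof.
move=> HPhi Cu CF; have [dg _] := C1_grad_sq Cu.
have du j y : differentiable (partial j u) y.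
  by have [_ /(_ j)[+ _]] := Cu; apply.
have dF j y : differentiable (flux Phi u j) y by have [+ _] := CF j; apply.
have [_ dPhi Phi0 _] := HPhi.
have := grad_sq_ge0 u x; rewrite le_eqVlt => /predU1P[g0|g0]; last first.
  have [d1 _ _] := dPhi _ g0.
  split.
    apply: diff_derivable; apply: (@differentiable_comp _ _ _ _ _ Phi) => //.
    exact/derivable1_diffP.
  have Hd : is_derive (grad_sq u x) 1 Phi (derive1 Phi (grad_sq u x)).
    by rewrite derive1E; exact/derivableP.
  rewrite (derive_comp1 _ Hd)// derive_grad_sq// mulr_sumr.
  by apply: eq_bigr => j _; rewrite /flux; ring.
have p0 j : partial j u x = 0 by exact: grad_sq_eq0.
have F0 j : flux Phi u j x = 0 by rewrite /flux p0 mulr0.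
rewrite big1; last by move=> j _; rewrite F0 mulr0 mul0r.
pose b y := \sum_(j < N) 2 * (partial j u y * flux Phi u j y).
apply: (@is_derive_squeeze0 _ _ _ b).
- move=> y; rewrite (_ : b y = 2 * grad_sq u y * derive1 Phi (grad_sq u y)).
    by apply: Phi_bounds => //; exact: grad_sq_ge0.
  rewrite /b /flux /grad_sq -mulrA mulr_suml mulr_sumr.
  by apply: eq_bigr => j _; rewrite expr2; ring.
- by rewrite /b big1// => j _; rewrite F0 mulr0 mulr0.
have dpF j : derivable (fun y => partial j u y * flux Phi u j y) x v.
  by apply: derivableM; exact: diff_derivable.
have bE : b = \sum_(j < N) (fun y => 2 * (partial j u y * flux Phi u j y)).
  by apply/funext => y; rewrite fct_sumE.
have d2 j : derivable (fun y => 2 * (partial j u y * flux Phi u j y)) x v.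
  by have [] := is_derive_cstM 2 (derivableP (dpF j)).
split; first by rewrite bE; exact: derivable_sum.
rewrite bE derive_sum// big1// => j _.
rewrite (@derive_val _ _ _ _ _ _ _ (is_derive_cstM 2 (derivableP (dpF j)))).
rewrite deriveM//; try exact: diff_derivable.
by rewrite p0 F0 !scale0r addr0 mulr0.
Qed.

Section Energy.
Variables (N m : nat) (Phi : R -> R) (H : 'I_m -> 'rV[R]_m -> R)
  (Ht : 'rV[R]_m -> R) (u : 'I_m -> 'rV[R]_N.+1 -> R).

Definition energy (x : 'rV[R]_N.+1) : R :=
  (\sum_(i < m) (2^-1 * Phi (grad_sq (u i) x)
     - derive1 Phi (grad_sq (u i) x) * `|partial ord_max (u i) x| ^+ 2))
  - Ht (values u x).

(** The sum over i is the vector field of the conservation law satisfied by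
    energy. *)
Definition momentum (i : 'I_m) (j : 'I_N) (x : 'rV[R]_N.+1) : R :=
  flux Phi (u i) (lift ord_max j) x * partial ord_max (u i) x.

Hypotheses (HPhi : admissible_Phi Phi) (HC1 : forall i, C1 (H i))
  (HtH : forall (i : 'I_m)
      (v : 'rV[R]_m), is_derive v (delta_mx 0 i) Ht (H i v))
  (usol : classical_solution Phi H u).

Lemma C1_momentum i j : C1 (momentum i j).
Proof.
have [Cu CF _] := usol; apply: C1M; first exact: CF.
by have [_] := Cu i; apply.
Qed.

Lemma differentiable_Ht x : differentiable Ht x.
Proof.
by apply: differentiable_partials HtH _ => i; apply: C1_continuous; exact: HC1.
Qed.

(** The conservation law: the equation cancels the derivatives of the fluxes in
    the last variable, the second derivatives of u commute, and a divergence in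
    the other variables is left. *)
Lemma is_derive_energy x :
  is_derive x (delta_mx 0 ord_max) energy
    (\sum_(i < m) \sum_(j < N) partial (lift ord_max j) (momentum i j) x).
Proof.
have [Cu CF ueq] := usol; set en := delta_mx 0 ord_max.
have du i y : differentiable (u i) y by have [[+ _] _] := Cu i; apply.
have dp i j y : differentiable (partial j (u i)) y.
  by have [_ /(_ j)[+ _]] := Cu i; apply.
have dF i j y : differentiable (flux Phi (u i) j) y by have [+ _] := CF i j;
    apply.
have E : energy = (\sum_(i < m) (fun y => 2^-1 * Phi (grad_sq (u i) y)
    - flux Phi (u i) ord_max y * partial ord_max (u i) y)) - (fun y =>
        Ht (\row_i u i y)).
  apply/funext => y; rewrite /energy /values fctE fct_sumE; congr (_ - _).
  apply: eq_bigr => i _; rewrite real_normK ?num_real//.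
  by rewrite /flux expr2 mulrA.
have dFp i : derivable (fun y =>
    flux Phi (u i) ord_max y * partial ord_max (u i) y) x en.
  by apply: derivableM; exact: diff_derivable.
have DP i := is_derive_Phi_grad_sq x en HPhi (Cu i) (CF i).
have dP2 i : derivable (fun y => 2^-1 * Phi (grad_sq (u i) y)) x en.
  by have [] := is_derive_cstM 2^-1 (DP i).
have dA i : derivable (fun y => 2^-1 * Phi (grad_sq (u i) y)
    - flux Phi (u i) ord_max y * partial ord_max (u i) y) x en.
  exact: derivableB.
have dHt : differentiable (fun y => Ht (\row_i u i y)) x.
  apply: (@differentiable_comp _ _ _ _ (fun y => \row_i u i y) Ht).
    exact: differentiable_row.
  exact: differentiable_Ht.
rewrite E; split.
  by apply: derivableB; [exact: derivable_sum|exact: diff_derivable].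
rewrite deriveB; [|exact: derivable_sum|exact: diff_derivable].
rewrite derive_sum// derive_comp_row//; last exact: differentiable_Ht.
rewrite -sumrB; apply: eq_bigr => i _.
rewrite deriveB// (@derive_val _ _ _ _ _ _ _ (is_derive_cstM 2^-1 (DP i))).
rewrite deriveM; [|exact: diff_derivable|exact: diff_derivable].
have -> : partial i Ht (\row_i0 u i0 x) = H i (values u x).
  by rewrite /partial (@derive_val _ _ _ _ _ _ _ (HtH i _)).
rewrite -ueq /divergence.
have schw j : 'D_en (partial j (u i)) x = partial j (partial ord_max (u i)) x.
  exact: schwarz.
set n : 'I_N.+1 := ord_max; set p := partial n (u i) x.
have S1 : \sum_(j < N.+1) 2 * flux Phi (u i) j x * 'D_en (partial j (u i)) x =
    2 * (flux Phi (u i) n x * partial n (partial n (u i)) x + \sum_(j < N)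
      flux Phi (u i) (lift n j) x * partial (lift n j) (partial n (u i)) x).
  under eq_bigr do rewrite schw -mulrA.
  by rewrite -mulr_sumr (bigD1_ord n).
have S2 : \sum_(j < N.+1) partial j (flux Phi (u i) j) x =
    partial n (flux Phi (u i) n) x +
    \sum_(j < N) partial (lift n j) (flux Phi (u i) (lift n j)) x.
  by rewrite (bigD1_ord n).
have S3 : \sum_(j < N) partial (lift n j) (momentum i j) x =
    (\sum_(j < N) flux Phi (u i) (lift n j) x * partial (lift n j)
        (partial n (u i)) x)
    + p * \sum_(j < N) partial (lift n j) (flux Phi (u i) (lift n j)) x.
  rewrite mulr_sumr -big_split/=; apply: eq_bigr => j _.
  by rewrite /momentum partialM.
rewrite S3 S2 S1 schw.
set X := partial n (partial n (u i)) x; set Y := 'D_en (flux _ _ _) x.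
have -> : partial n (flux Phi (u i) n) x = Y by [].
set F := flux Phi (u i) n x; set A := \sum_(j < N) _ * _;
    set B := \sum_(j < N) _.
rewrite -[F *: X]/(F * X) -[p *: Y]/(p * Y).
rewrite -[X in _ - X * _]/p.
by field.
Qed.
End Energy.
End EnergyDensity.

(** * Integrals over the balls of a slice *)

Section Slices.
Context {R : realType}.

(** join on row vectors, on which the differential calculus lives. *)
Definition joinr N (v : 'rV[R]_N) (t : R) : 'rV[R]_N.+1 :=
  \row_j (if unlift ord_max j is Some k then v 0 k else t).

Lemma join_row N (y : N.-tuple R) t : join y t = joinr (row_of y) t.
Proof. by apply/rowP => j; rewrite !mxE; case: unlift => // k; rewrite mxE. Qed.

Lemma joinr_line N (v : 'rV[R]_N) t :
  joinr v t = joinr v 0 + t *: delta_mx 0 ord_max.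
Proof.
apply/rowP => j; rewrite !mxE eqxx /=.
case: unliftP => [k ->|->]; last by rewrite eqxx mulr1 add0r.
by rewrite eq_sym (negPf (neq_lift _ _)) mulr0 addr0.
Qed.

Lemma C1_joinr N (f : 'rV[R]_N.+1 -> R) t : C1 f -> C1 (fun v => f (joinr v t)).
Proof.
move=> Cf; apply: (@C1_comp_row _ _ _ f (fun j (v : 'rV[R]_N) =>
  if unlift ord_max j is Some k then v 0 k else t)) => // j.
by case: unlift => [k|]; [exact: C1_coord|exact: C1_cst].
Qed.

Lemma partial_joinr N (f : 'rV[R]_N.+1 -> R) t j v : C1 f ->
  partial j (fun v => f (joinr v t)) v = partial (lift ord_max j) f (joinr v t).
Proof.
move=> [df _]; pose g i (v : 'rV[R]_N) : R :=
  if unlift ord_max i is Some k then v 0 k else t.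
have dg i : differentiable (g i) v.
  by rewrite /g; case: unlift => [k|];
      [exact: differentiable_coord|exact: differentiable_cst].
rewrite /partial (@derive_comp_row _ _ _ f g)//.
rewrite (bigD1_ord ord_max)//= {1}/g unlift_none derive_cst mul0r add0r.
rewrite (bigD1 j)//= big1 ?addr0; last first.
  by move=> k kj; rewrite {1}/g liftK derive_coord mxE (negPf kj) andbF mul0r.
by rewrite {1}/g liftK derive_coord mxE !eqxx mul1r.
Qed.

Lemma continuous_joinr_fst N (f : 'rV[R]_N.+1 -> R) t : continuous f ->
  continuous (fun v : 'rV[R]_N => f (joinr v t)).
Proof.
move=> cf v; apply: (@continuous_comp _ _ _ (fun v : 'rV[R]_N => joinr v t) f);
    last exact: cf.
apply: continuous_row => j; case: unlift => [k|];
    [exact: coord_continuous|exact: cst_continuous].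
Qed.

Lemma continuous_joinr_snd N (f : 'rV[R]_N.+1 ->
    R) (v : 'rV[R]_N) : continuous f ->
  continuous (fun t => f (joinr v t)).
Proof.
move=> cf t; apply: (@continuous_comp _ _ _ (fun t : R => joinr v t) f);
    last exact: cf.
by apply: continuous_row => j; case: unlift => [k|];
    [exact: cst_continuous|exact: cvg_id].
Qed.

Lemma bounded_slab N (f : 'rV[R]_N.+1 -> R) (r T : R) : continuous f ->
  exists2 M, 0 <= M & forall (y : N.-tuple R) t, eball r y -> `|t| <= T ->
    `|f (join y t)| <= M.
Proof.
move=> cf; have [M M0 HM] := bounded_on_cube (Num.max r T) cf.
exists M => // y t /eball_cube yr tT; apply: HM => j; rewrite mxE.
by case: unlift => [k|]; rewrite le_max ?yr// tT orbT.
Qed.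

Lemma integrable_continuous_join N (f : 'rV[R]_N.+1 -> R) r t : continuous f ->
  (lebesgueN N).-integrable (eball r) (fun y => (f (join y t))%:E).
Proof.
move=> cf; have := integrable_continuous_row r (continuous_joinr_fst (t:=t) cf).
by congr (_.-integrable _ _); apply/funext => y /=; rewrite join_row.
Qed.

Lemma norm_le_near (s t : R) : t - 1 < s -> s < t + 1 -> `|s| <= `|t| + 1.
Proof.
by move=> s1 s2; rewrite ler_norml; have := ler_norm t; have := ler_norm (- t);
   rewrite normrN => ? ?; apply/andP; split; lra.
Qed.

Lemma continuous_ball_integral N (f : 'rV[R]_N.+1 -> R) r : continuous f ->
  continuous (fun t => ball_integral r (fun y => f (join y t))).
Proof.
move=> cf t.
have [M M0 HM] := @bounded_slab _ f r (`|t| + 1) cf.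
have It : t \in (`](t - 1),
    (t + 1)[%classic : set R) by rewrite inE/= in_itv/=; lra.
have H1 s : `](t - 1), (t + 1)[%classic s ->
    (lebesgueN N).-integrable (eball r) (EFin \o (fun y => f (join y s))).
  by move=> _; exact: integrable_continuous_join.
have H2 : {ae lebesgueN N, forall y, eball r y ->
    {in (`](t - 1), (t + 1)[%classic : set R), continuous (fun s =>
        f (join y s))}}.
  apply: aeW => y _ s _.
  have -> : (fun s => f (join y s)) = (fun s => f (joinr (row_of y) s)).
    by apply/funext => s'; rewrite join_row.
  exact: continuous_joinr_snd.
have H3 : (lebesgueN N).-integrable (eball r) (EFin \o (fun=> M)).
  by apply: (@integrable_continuous_row R N r (fun=> M)) => v;
      exact: cst_continuous.
have H4 s : `](t - 1), (t + 1)[%classic s ->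
    {ae lebesgueN N, forall y, eball r y -> `|f (join y s)| <= M}.
  rewrite /= in_itv/= => /andP[s1 s2]; apply: aeW => y yr; apply: HM => //.
  exact: norm_le_near.
exact: (continuity_under_integral (@measurable_eball R N r) H1 H2 H3 H4 It).
Qed.

Lemma ball_integral_derive N (e de : 'rV[R]_N.+1 -> R) (r t : R) :
  continuous e -> continuous de ->
  (forall x, is_derive x (delta_mx 0 ord_max) e (de x)) ->
  is_derive t 1 (fun t => ball_integral r (fun y => e (join y t)))
    (ball_integral r (fun y => de (join y t))).
Proof.
move=> ce cde ed.
have [M M0 HM] := @bounded_slab _ de r (`|t| + 1) cde.
have It : `](t - 1), (t + 1)[%classic t by rewrite /= in_itv/=; lra.
have dl (s : R) (y : N.-tuple R) : is_derive s 1 (fun s =>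
    e (join y s)) (de (join y s)).
  have -> : (fun s => e (join y s)) = (fun s =>
      e (joinr (row_of y) 0 + s *: delta_mx 0 ord_max)).
    by apply/funext => s'; rewrite join_row joinr_line.
  apply: (is_derive_lineP _ _ _ _ _).1; rewrite -joinr_line join_row.
  exact: ed.
have H1 s : `](t - 1), (t + 1)[%classic s ->
    (lebesgueN N).-integrable (eball r) (EFin \o (fun y => e (join y s))).
  by move=> _; exact: integrable_continuous_join.
have H2 s (y : N.-tuple R) : `](t - 1), (t + 1)[%classic s -> eball r y ->
    derivable (fun s => e (join y s)) s 1.
  by move=> _ _; have [] := dl s y.
have H3 (y : N.-tuple R) : 0 <= M by [].
have H4 : (lebesgueN N).-integrable (eball r) (EFin \o (fun=> M)).
  by apply: (@integrable_continuous_row R N r (fun=> M)) => v;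
      exact: cst_continuous.
have dE s (y : N.-tuple R) : partial1of2 (fun s y =>
    e (join y s)) s y = de (join y s).
  by rewrite partial1of2E; have [_ ->] := dl s y.
have H5 s (y : N.-tuple R) : `](t - 1), (t + 1)[%classic s -> eball r y ->
    `|partial1of2 (fun s y => e (join y s)) s y| <= M.
  rewrite /= in_itv/= => /andP[s1 s2] yr; rewrite dE; apply: HM => //.
  exact: norm_le_near.
have mB := @measurable_eball R N r.
split; first exact: (derivable_under_integral mB It H1 H2 H3 H4 H5).
rewrite -derive1E (differentiation_under_integral mB It H1 H2 H3 H4 H5).
by apply: eq_Rintegral => y _; rewrite dE.
Qed.
End Slices.

Section LateralFlux.
Context {R : realType}.
Local Notation mu := (@lebesgue_measure R).

Lemma oriented_integral_FTC (F S : R -> R) t :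
  (forall s : R, is_derive s 1 F (S s)) -> continuous S ->
  oriented_integral S t = F t - F 0.
Proof.
move=> FS cS; have cF : continuous F.
  by move=> s; apply: differentiable_continuous; apply/derivable1_diffP;
      have [] := FS s.
have key (a b : R) : a < b -> \int[mu]_(s in `[a, b]) S s = F b - F a.
  move=> ab; rewrite /Rintegral (@continuous_FTC2 _ S F)//.
  - exact: continuous_subspaceT.
  - split; first by move=> s _; have [] := FS s.
    + exact/cvg_at_right_filter/cF.
    + exact/cvg_at_left_filter/cF.
  - by move=> s _; rewrite derive1E; have [_ ->] := FS s.
rewrite /oriented_integral; case: ifPn => [|].
  rewrite le_eqVlt => /predU1P[<-|/key->//].
  by rewrite set_itv1 Rintegral_set1 subrr.
by rewrite -ltNge => /key ->; rewrite opprB.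
Qed.

Lemma oriented_integral_sum m (S : 'I_m -> R -> R) t :
  (forall i, continuous (S i)) ->
  oriented_integral (fun s => \sum_(i < m) S i s) t =
  \sum_(i < m) oriented_integral (S i) t.
Proof.
move=> cS; have intS i (a b : R) : mu.-integrable `[a, b] (EFin \o S i).
  apply: continuous_compact_integrable; first exact: segment_compact.
  exact: continuous_subspaceT.
rewrite /oriented_integral; case: ifPn => _.
  by rewrite Rintegral_sum.
by rewrite Rintegral_sum// sumrN.
Qed.

(** Where grad u = 0, Phi (grad_sq u) is continuous by the squeeze used for its
    derivative. *)
Lemma continuous_energy N m (Phi : R -> R) (H : 'I_m -> 'rV[R]_m -> R)
    (Ht : 'rV[R]_m -> R) (u : 'I_m -> 'rV[R]_N.+1 -> R) :
  admissible_Phi Phi -> (forall i, C1 (H i)) ->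
  (forall (i : 'I_m) (v : 'rV[R]_m), is_derive v (delta_mx 0 i) Ht (H i v)) ->
  classical_solution Phi H u -> continuous (energy Phi Ht u).
Proof.
move=> HPhi HC1 HtH usol x; have [Cu CF _] := usol.
have [_ dPhi Phi0 _] := HPhi.
have cp i j : continuous (partial j (u i)).
  by have [_ /(_ j)/C1_continuous] := Cu i.
have cFl i j : continuous (flux Phi (u i) j) by exact: C1_continuous.
have cg i : continuous (grad_sq (u i)) by exact/C1_continuous/C1_grad_sq.
have cPhi i : {for x, continuous (fun y => Phi (grad_sq (u i) y))}.
  have := grad_sq_ge0 (u i) x; rewrite le_eqVlt => /predU1P[g0|g0]; last first.
    apply: (@continuous_comp _ _ _ (grad_sq (u i)) Phi); first exact: cg.
    have [d1 _ _] := dPhi _ g0.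
    by apply: differentiable_continuous; exact/derivable1_diffP.
  pose b y := 2 * \sum_(j < N.+1) flux Phi (u i) j y * partial j (u i) y.
  have cb : b y @[y --> x] --> b x.
    have cs : {for x, continuous (fun y => \sum_(j < N.+1)
        flux Phi (u i) j y * partial j (u i) y)}.
      apply: (@continuous_sum R _ _ (fun j y =>
          flux Phi (u i) j y * partial j (u i) y)) => j.
      exact: (continuousM (cFl i j x) (cp i j x)).
    by apply: (@continuousM _ _ (cst 2)) cs; exact: cst_continuous.
  have b0 : b x = 0.
    by rewrite /b big1 ?mulr0// => j _; rewrite (grad_sq_eq0 j (esym g0)) mulr0.
  rewrite b0 in cb.
  suff : Phi (grad_sq (u i) y) @[y --> x] --> (0 : R).
    by rewrite -[X in _ --> X -> _]Phi0 g0.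
  have c0 : cst (0 : R) y @[y --> x] --> (0 : R) by exact: cst_continuous.
  apply: (squeeze_cvgr _ c0 cb).
  near=> y; have /andP[-> h] := Phi_bounds HPhi (grad_sq_ge0 (u i) y).
  rewrite (le_trans h)// /b -mulrA ler_wpM2l// /grad_sq mulr_suml.
  rewrite (_ : \sum_(j < N.+1) _ = \sum_(j < N.+1) flux Phi (u i) j y * partial
      j (u i) y)//.
  by apply: eq_bigr => j _; rewrite /flux expr2; ring.
have -> : energy Phi Ht u = (fun y => \sum_(i < m) (2^-1 * Phi (grad_sq (u i) y)
    - flux Phi (u i) ord_max y * partial ord_max (u i) y)) - (fun y =>
        Ht (\row_i u i y)).
  apply/funext => y; rewrite /energy /values fctE; congr (_ - _).
  apply: eq_bigr => i _; rewrite real_normK ?num_real//.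
  by rewrite /flux expr2 mulrA.
apply: continuousB.
  apply: continuous_sum => i.
  have c1 : {for x, continuous (fun y => 2^-1 * Phi (grad_sq (u i) y))}.
    by apply: (@continuousM _ _ (cst 2^-1) (fun y => Phi (grad_sq (u i) y))) =>
        //; exact: cst_continuous.
  exact: (continuousB c1 (continuousM (cFl i ord_max x) (cp i ord_max x))).
apply: (@continuous_comp _ _ _ (fun y => \row_i u i y : 'rV[R]_m) Ht).
  by apply: continuous_row => i; apply: C1_continuous; have [] := Cu i.
by apply: differentiable_continuous; exact: (differentiable_Ht HC1 HtH).
Unshelve. all: by end_near. Qed.

(** The height derivative of the integral of the energy over the ball is the
    integral of a divergence, hence the flux through the sphere; then integrate
    from height 0 to t. *)
Lemma lateral_fluxE N m (Phi : R -> R) (H : 'I_m -> 'rV[R]_m -> R)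
    (Ht : 'rV[R]_m -> R) (u : 'I_m -> 'rV[R]_N.+1 -> R) r t :
  admissible_Phi Phi -> (forall i, C1 (H i)) ->
  (forall (i : 'I_m) (v : 'rV[R]_m), is_derive v (delta_mx 0 i) Ht (H i v)) ->
  classical_solution Phi H u -> (0 < N)%N -> 0 < r ->
  lateral_flux Phi u r t = ball_integral r (hamiltonian_density Phi Ht u t)
    - ball_integral r (hamiltonian_density Phi Ht u 0).
Proof.
move=> HPhi HC1 HtH usol N0 r0.
pose h i x := \sum_(j < N) partial (lift ord_max j) (momentum Phi u i j) x.
have CP i j : C1 (momentum Phi u i j) := C1_momentum usol i j.
have ch i : continuous (h i).
  by move=> x; apply: continuous_sum => j; have [_] := CP i j; apply.
pose S i s := ball_integral r (fun y => h i (join y s)).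
have cS i : continuous (S i) by exact: continuous_ball_integral.
rewrite /lateral_flux.
have SE i : (fun s => sphere_integral r (fun y =>
    derive1 Phi (grad_sq (u i) (join y s)) * normal_derivative (u i) y s
    * partial ord_max (u i) (join y s))) = S i.
  apply/funext => s; rewrite /S.
  transitivity (sphere_integral r (fun y => \sum_(j < N) tnth y j / enorm y *
      (fun v => momentum Phi u i j (joinr v s)) (row_of y))).
    congr (sphere_integral r _); apply/funext => y.
    rewrite /normal_derivative mulr_sumr mulr_suml; apply: eq_bigr => j _.
    rewrite -join_row /momentum /flux; set a := derive1 Phi _.
    set b := partial (lift _ _) _ _; set c := partial ord_max _ _.
    by set q := tnth y j / _; ring.
  have CPs j : C1 (fun v => momentum Phi u i j (joinr v s)) by exact: C1_joinr.
  have <- := divergence_ball N0 r0 CPs.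
  apply: eq_Rintegral => y _; apply: eq_bigr => j _.
  by rewrite join_row; exact: partial_joinr.
under eq_bigr do rewrite SE.
rewrite -oriented_integral_sum//.
apply: (oriented_integral_FTC (F := fun t =>
    ball_integral r (hamiltonian_density Phi Ht u t))); last first.
  by move=> s; apply: continuous_sum => i; exact: cS.
move=> s; have -> : \sum_(i < m) S i s = ball_integral r (fun y =>
    \sum_(i < m) h i (join y s)).
  rewrite /ball_integral Rintegral_sum//; first exact: measurable_eball.
  by move=> i; exact: integrable_continuous_join.
apply: (@ball_integral_derive _ _ (energy Phi Ht u) (fun x =>
    \sum_(i < m) h i x)).
- exact: continuous_energy HtH usol.
- by move=> x; apply: continuous_sum => i; exact: ch.
- by move=> x; exact: is_derive_energy usol x.
Qed.
End LateralFlux.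

(** * From balls to the whole slice *)

Section WholeSlice.
Context {R : realType}.

Lemma subset_eball N (r s : R) : r <= s ->
    eball r `<=` (eball s : set (N.-tuple R)).
Proof. by move=> rs y /lt_le_trans; apply. Qed.

(** The radii need not be monotone: the balls of integer radius at most r k
    bound the integrals from below, and monotone convergence applies to
    them. *)
Lemma cvg_integral_eball N (f : N.-tuple R -> \bar R) (r : nat -> R) :
  measurable_fun [set: N.-tuple R] f -> (forall y, 0 <= f y)%E ->
  r @ \oo --> +oo ->
  (\int[lebesgueN N]_(y in eball (r k)) f y)%E @[k --> \oo] -->
  (\int[lebesgueN N]_y f y)%E.
Proof.
move=> mf f0 roo; pose B (n : nat) : set (N.-tuple R) := eball n%:R.
have mB n : measurable (B n) by exact: measurable_eball.
have nnB : {homo B : n m / (n <= m)%N >-> (n <= m)%O}.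
  by move=> n m nm; rewrite subsetEset; apply: subset_eball; rewrite ler_nat.
have UB : \bigcup_n B n = setT.
  apply/seteqP; split => // y _; exists (Num.trunc (enorm y)).+1 => //.
  exact: truncnS_gt.
have := @ge0_nondecreasing_set_cvg_integral _ _ _ B f (lebesgueN N) nnB mB
  (fun n => measurable_funTS mf) (fun _ y _ => f0 y).
rewrite UB => L.
have noo : Num.trunc (r k) @[k --> \oo] --> \oo.
  apply/cvgnyPge => A; have /cvgryPge/(_ A%:R) := roo.
  apply: filterS => k Ak; rewrite truncn_ge_nat//.
  exact: le_trans Ak.
apply: (squeeze_cvge _ (cvg_comp _ _ noo L) (@cvg_cst _ _ _ _ _)).
have /cvgryPge/(_ 0) := roo; apply: filterS => k k0.
have mBr := @measurable_eball R N (r k).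
apply/andP; split.
  apply: ge0_subset_integral => //; first exact: measurable_funTS.
  by apply: subset_eball; rewrite truncn_le.
exact: ge0_subset_integral.
Qed.

Lemma lebesgue_integral_of_balls N (g : N.-tuple R -> R) (r : nat -> R) C :
  r @ \oo --> +oo -> has_lebesgue_integral g ->
  (forall s, (lebesgueN N).-integrable (eball s) (EFin \o g)) ->
  is_integral_along r g C -> (\int[lebesgueN N]_y (g y)%:E = C%:E)%E.
Proof.
move=> roo [mg gfin] gi gC.
have mEg : measurable_fun [set: N.-tuple R] (EFin \o g) by
    exact/measurable_EFinP.
have Lp := cvg_integral_eball (measurable_funepos mEg) (funepos_ge0 _) roo.
have Ln := cvg_integral_eball (measurable_funeneg mEg) (funeneg_ge0 _) roo.
have p0 : (0 <= \int[lebesgueN N]_y (EFin \o g)^\+ y)%E by apply: integral_ge0.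
have n0 : (0 <= \int[lebesgueN N]_y (EFin \o g)^\- y)%E by apply: integral_ge0.
have def : ((\int[lebesgueN N]_y (EFin \o g)^\+ y) +? - (\int[lebesgueN N]_y
    (EFin \o g)^\- y))%E.
  case: gfin => [h|h].
  - by apply: fin_num_adde_defr; rewrite ge0_fin_numE.
  - by apply: fin_num_adde_defl; rewrite fin_numN ge0_fin_numE.
have L := cvgeB def Lp Ln.
rewrite -integralE in L.
have LC : (\int[lebesgueN N]_(y in eball (r k)) (EFin \o g)^\+ y -
   \int[lebesgueN N]_(y in eball (r k))
       (EFin \o g)^\- y)%E @[k --> \oo] --> C%:E.
  rewrite (_ : (fun k => _) = (fun k => (ball_integral (r k) g)%:E)).
    by apply: cvg_EFin; [exact: nearW|exact: gC].
  apply/funext => k; rewrite -integralE /ball_integral /Rintegral fineK//.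
  have mBr := @measurable_eball R N (r k).
  exact: (integrable_fin_num mBr (gi _)).
exact: (cvg_unique (@ereal_hausdorff R) (L _) LC).
Qed.
End WholeSlice.

(* The dimension n of the space is N.+1, so that x' ranges over R^N. *)
Theorem theorem2p1 (R : realType) (N m : nat) (N_gt0 : (0 < N)%N)
    (m_gt0 : (0 < m)%N)
    (Phi : R -> R) (Phi_adm : admissible_Phi Phi)
    (H : 'I_m -> 'rV[R]_m -> R) (H_C1 : forall i, C1 (H i))
    (H_sym : forall (i j : 'I_m) (v : 'rV[R]_m), (i <= j)%N ->
       0 < partial i (H j) v * partial j (H i) v)
    (Ht : 'rV[R]_m -> R)
    (Ht_H : forall (i : 'I_m) (v : 'rV[R]_m),
       is_derive v (delta_mx 0 i) Ht (H i v))
    (u : 'I_m -> 'rV[R]_N.+1 -> R) (u_sol : classical_solution Phi H u)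
    (r : nat -> R) (r_infty : r @ \oo --> +oo)
    (finite_slice : exists (t0 l : R),
       is_integral_along r (hamiltonian_density Phi Ht u t0) l)
    (lateral_flux0 : forall t : R,
       (fun k => lateral_flux Phi u (r k) t) @ \oo --> (0 : R)) :
  exists C : R, forall t : R,
    is_integral_along r (hamiltonian_density Phi Ht u t) C /\
    (has_lebesgue_integral (hamiltonian_density Phi Ht u t) ->
     (\int[lebesgueN N]_y (hamiltonian_density Phi Ht u t y)%:E = C%:E)%E).
Proof.
have [t0 [l Hl]] := finite_slice.
set hd := hamiltonian_density Phi Ht u in Hl *.
have fluxE k t : 0 < r k ->
    lateral_flux Phi u (r k) t = ball_integral (r k)
        (hd t) - ball_integral (r k) (hd 0).
  by move=> rk; exact: lateral_fluxE Phi_adm H_C1 Ht_H u_sol N_gt0 rk.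
have along t : is_integral_along r (hd t) l.
  have L : (fun k => ball_integral (r k) (hd t0) +
      (lateral_flux Phi u (r k) t - lateral_flux Phi u (r k) t0)) @ \oo --> l +
          (0 - 0).
    by apply: cvgD => //; apply: cvgB; exact: lateral_flux0.
  rewrite subrr addr0 in L.
  apply: cvg_trans L; apply: near_eq_cvg.
  have /cvgryPgt/(_ 0) := r_infty; apply: filterS => k rk.
  by rewrite !fluxE//; ring.
exists l => t; split => // tint.
apply: (lebesgue_integral_of_balls r_infty tint _ (along t)) => s.
exact: (integrable_continuous_join s t (continuous_energy Phi_adm H_C1 Ht_H
    u_sol)).
Qed.
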